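(* Let $d\ge2$ be an integer and $\gamma>d-1$. Let $S=(S_t,\,t\in\mathbb{R}_+)$ be the $(0,+\infty)$-valued diffusion solving $$dS_t=\Bigl(\frac{d-1}{2}\coth(S_t)-\frac{\gamma}{2}\tanh(S_t)\Bigr)dt+dW_t,$$ with $W$ a standard one-dimensional Wiener process, and put $N_{d,\gamma}=\int_0^\infty\cosh(s)^{-\gamma}\sinh(s)^{d-1}\,ds$. Then the energy process $P_0(t)=\cosh(S_t)$ has an invariant density $\varphi_{P_0}$ with respect to Lebesgue measure on $(\mathbb{R},\mathcal{B}(\mathbb{R}))$ given by $$\varphi_{P_0}(p_0)=\frac{1}{N_{d,\gamma}}\,p_0^{-\gamma}(p_0^2-1)^{(d-2)/2}\,1_{[1,+\infty)}(p_0),\qquad p_0\in\mathbb{R}.$$ The speed process $|V|=\sqrt{V_1^2+\dots+V_d^2}$, that is $|V(t)|=\tanh(S_t)$, has an invariant density $\varphi_{|V|}$ with respect to Lebesgue measure on $([0,1],\mathcal{B}([0,1]))$ given by $$\varphi_{|V|}(v)=\frac{1}{N_{d,\gamma}}\,v^{d-1}(1-v^2)^{(\gamma-(d+1))/2},\qquad v\in[0,1].$$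
   Context: The relativistic Ornstein–Uhlenbeck momentum process (with mass $m=1$) is $\mathbf{P}(t)=(P_0(t),P(t))$ with $P_0(t)=\cosh(S_t)$, $P(t)=\sinh(S_t)\,\Omega_t$, where $\Omega_t=\Theta_{\tau(t)}\in S^{d-1}$, $\tau(t)=\int_0^t\sinh(S_r)^{-2}dr$, and $\Theta$ is a Wiener process (generator $\frac12$ times the Laplace–Beltrami operator) on the unit sphere $S^{d-1}\subset\mathbb{R}^d$, independent of $S$. The velocity process is $V(t)=P(t)/P_0(t)=\tanh(S_t)\,\Omega_t=(V_1(t),\dots,V_d(t))$. A density is invariant for a Markov process if, when the initial value has this density, the process has this density at every time $t\ge0$. *)

(* Defs.v *)
From HB Require Import structures.
From mathcomp Require Import all_boot all_order all_algebra.
From mathcomp Require Import all_classical all_reals all_analysis.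

Set Implicit Arguments.
Unset Strict Implicit.
Unset Printing Implicit Defensive.

Import Order.TTheory GRing.Theory Num.Theory.
Import numFieldNormedType.Exports.

Local Open Scope classical_set_scope.
Local Open Scope ring_scope.

Section hyperbolic_functions.
Context {R : realType}.
Implicit Type x : R.

Definition cosh x : R := (expR x + expR (- x)) / 2.
Definition sinh x : R := (expR x - expR (- x)) / 2.
Definition tanh x : R := sinh x / cosh x.
Definition coth x : R := cosh x / sinh x.

End hyperbolic_functions.

(* Processes are families indexed by all reals of which only the times t >= 0
   are ever constrained or observed. *)
Section stochastic_processes.
Context {R : realType} {dT : measure_display} {T : measurableType dT}.
Variable P : probability T R.

Definition continuous_paths {V : topologicalType} (X : R -> T -> V) : Prop :=
  forall w, {within `[0, +oo[, continuous (fun t => X t w)}.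

Definition sigma_gen {J : Type} (I : set J) (X : J -> T -> R) : set (set T) :=
  <<s \bigcup_(j in I) preimage_set_system setT (X j) measurable >>.

Definition independent_systems (G H : set (set T)) : Prop :=
  forall A B, G A -> H B -> P (A `&` B) = (P A * P B)%E.

Record is_filtration (F : R -> set (set T)) : Prop := IsFiltration {
  filtration_sigma_algebra : forall t, 0 <= t -> sigma_algebra setT (F t) ;
  filtration_measurable : forall t, 0 <= t -> F t `<=` measurable ;
  filtration_nondecreasing :
    forall s t, 0 <= s -> s <= t -> F s `<=` F t }.

Definition adapted (F : R -> set (set T)) (X : R -> T -> R) : Prop :=
  forall t, 0 <= t -> forall B, measurable B -> F t (X t @^-1` B).

(* [normal_prob] takes the standard deviation, not the variance. *)
Record is_wiener (F : R -> set (set T)) (W : R -> T -> R) : Prop := IsWiener {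
  wiener_adapted : adapted F W ;
  wiener_continuous : continuous_paths W ;
  wiener_start : {ae P, forall w, W 0 w = 0} ;
  wiener_increment_law : forall s t, 0 <= s -> s < t ->
    forall B, measurable B ->
      P ((W t \- W s) @^-1` B) = normal_prob 0 (Num.sqrt (t - s)) B ;
  wiener_increment_indep : forall s t, 0 <= s -> s < t ->
    independent_systems (F s)
      (preimage_set_system setT (W t \- W s) measurable) }.

(* The noise is additive, so the stochastic integral in the integrated form of
   dS = b(S) dt + dW is just W t - W 0, with W 0 = 0. *)
Record is_rou_diffusion (d : nat) (gamma : R) (F : R -> set (set T))
    (W S : R -> T -> R) : Prop := IsRouDiffusion {
  rou_adapted : adapted F S ;
  rou_continuous : continuous_paths S ;
  rou_gt0 : forall t w, 0 <= t -> 0 < S t w ;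
  rou_sde : {ae P, forall w, forall t, 0 <= t ->
    S t w = S 0 w
      + \int[lebesgue_measure]_(r in `[0, t])
          ((d%:R - 1) / 2 * coth (S r w) - gamma / 2 * tanh (S r w))
      + W t w} }.

(* The law of X is carried by D and has density phi with respect to the
   restriction of Lebesgue measure to D. *)
Definition has_density (D : set R) (X : T -> R) (phi : R -> R) : Prop :=
  forall A, measurable A ->
    P (X @^-1` A) = (\int[lebesgue_measure]_(x in A `&` D) (phi x)%:E)%E.

Definition prob_density (D : set R) (phi : R -> R) : Prop :=
  [/\ measurable_fun D phi, (forall x, D x -> 0 <= phi x) &
      (\int[lebesgue_measure]_(x in D) (phi x)%:E = 1)%E].

Definition invariant_density (D : set R) (X : R -> T -> R) (phi : R -> R)
    : Prop :=
  prob_density D phi /\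
  (has_density D (X 0) phi -> forall t, 0 <= t -> has_density D (X t) phi).

End stochastic_processes.

Section sphere.
Context {R : realType} {d : nat}.
Implicit Types (x : 'rV[R]_d) (f g : 'rV[R]_d -> R).

(* The library norm on 'rV[R]_d is the sup norm. *)
Definition euclid_norm x : R := Num.sqrt (\sum_i x ord0 i ^+ 2).

Definition radial_ext f x : R := f ((euclid_norm x)^-1 *: x).

Definition partial (i : 'I_d) g x : R := 'D_(delta_mx ord0 i) g x.

(* f restricts to a C^2 function on the unit sphere *)
Definition sphere_C2 f : Prop := forall x, x != 0 -> forall i j : 'I_d,
  [/\ derivable (radial_ext f) x (delta_mx ord0 i),
      derivable (partial i (radial_ext f)) x (delta_mx ord0 j) &
      {for x, continuous (partial j (partial i (radial_ext f)))}].

(* At a point of the unit sphere, the Laplace-Beltrami operator is the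
   Euclidean Laplacian of the extension that is constant along rays. *)
Definition laplace_beltrami f x : R :=
  \sum_i partial i (partial i (radial_ext f)) x.

End sphere.

Section relativistic_process.
Context {R : realType} {dT : measure_display} {T : measurableType dT}.
Variable P : probability T R.

Definition coords {d : nat} (Theta : R -> T -> 'rV[R]_d) (ti : R * 'I_d)
  (w : T) : R := Theta ti.1 w ord0 ti.2.

Definition sphere_sigma {d : nat} (Theta : R -> T -> 'rV[R]_d) (I : set R)
    : set (set T) :=
  sigma_gen [set ti : R * 'I_d | I ti.1] (coords Theta).

(* Diffusion with generator (1/2) Laplace-Beltrami, as the solution of the
   martingale problem in its own filtration, with arbitrary initial law. *)
Record is_sphere_wiener (d : nat) (Theta : R -> T -> 'rV[R]_d) : Prop :=
  IsSphereWiener {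
  sphere_wiener_measurable : forall t i, 0 <= t ->
    measurable_fun setT (coords Theta (t, i)) ;
  sphere_wiener_continuous : continuous_paths Theta ;
  sphere_wiener_unit : forall t w, 0 <= t -> euclid_norm (Theta t w) = 1 ;
  sphere_wiener_martingale : forall f, sphere_C2 f ->
    forall s t, 0 <= s -> s <= t ->
    forall A, sphere_sigma Theta `[0, s] A ->
      (\int[P]_(w in A)
         (f (Theta t w) - f (Theta s w)
          - \int[lebesgue_measure]_(r in `[s, t])
              (2^-1 * laplace_beltrami f (Theta r w)))%R%:E = 0)%E }.

Definition independent_of_diffusion (d : nat) (Theta : R -> T -> 'rV[R]_d)
    (S : R -> T -> R) : Prop :=
  independent_systems P (sphere_sigma Theta `[0, +oo[) (sigma_gen `[0, +oo[ S).

Definition clock (S : R -> T -> R) (t : R) (w : T) : R :=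
  \int[lebesgue_measure]_(r in `[0, t]) (sinh (S r w)) ^- 2.

Definition energy (S : R -> T -> R) (t : R) (w : T) : R := cosh (S t w).

Definition momentum (d : nat) (Theta : R -> T -> 'rV[R]_d) (S : R -> T -> R)
    (t : R) (w : T) : 'rV[R]_d :=
  sinh (S t w) *: Theta (clock S t w) w.

Definition velocity (d : nat) (Theta : R -> T -> 'rV[R]_d) (S : R -> T -> R)
    (t : R) (w : T) : 'rV[R]_d :=
  (energy S t w)^-1 *: momentum Theta S t w.

Definition speed (d : nat) (Theta : R -> T -> 'rV[R]_d) (S : R -> T -> R)
    (t : R) (w : T) : R :=
  euclid_norm (velocity Theta S t w).

End relativistic_process.

Section densities.
Context {R : realType}.
Variables (d : nat) (gamma : R).

Definition norm_const : R :=
  \int[lebesgue_measure]_(s in `[0, +oo[)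
    (cosh s `^ (- gamma) * sinh s ^+ d.-1).

(* The indicator matters: powR is total, also on nonpositive bases. *)
Definition phi_energy (p : R) : R :=
  norm_const^-1 * (p `^ (- gamma) * (p ^+ 2 - 1) `^ ((d%:R - 2) / 2))
  * \1_(`[1, +oo[ : set R) p.

Definition phi_speed (v : R) : R :=
  norm_const^-1 *
  (v ^+ d.-1 * (1 - v ^+ 2) `^ ((gamma - (d%:R + 1)) / 2)).

End densities.

(* Main.v *)
(** The density [psi = cosh ^ (- gamma) * sinh ^ (d - 1) / N] solves
    [psi' = 2 b psi], where the drift [b] of [S] is nonincreasing on (0, +oo).
    Let [S 0] have density [psi] and freeze [b] below a small [eps]: the frozen
    drift, still written [b], is bounded, Lipschitz and nonincreasing, and there
    is a solution [Phi] of [Phi'' = 2 b Phi'] uniformly close to the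
    distribution function of [S 0].  Run the Euler scheme of the frozen equation
    with step [h], started at [S 0] and driven by the increments of [W].

    - In law: one Euler step is an increasing map followed by an independent
      Gaussian shift, so it does not increase the uniform distance of a
      distribution function to [Phi], up to the amount by which it moves [Phi]
      itself.  By a Taylor expansion and [Phi'' = 2 b Phi'], the latter is
      [O(h ^ (3/2))], hence the total error is [O(sqrt h)].
    - Along paths: the noise is additive and an Euler step is nonexpansive, so
      on every path of [S] staying above [eps] the scheme converges to [S].

    Letting [h] and then [eps] tend to 0, [S t] has the law of [S 0].  The
    densities of the energy and of the speed are the images of [psi] by [cosh]
    and [tanh]. *)

Require Import Defs.
From HB Require Import structures.
From mathcomp Require Import all_boot all_order all_algebra.
From mathcomp Require Import all_classical all_reals all_analysis.
From mathcomp Require Import measurable_realfun ring lra.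
Set Implicit Arguments.
Unset Strict Implicit.
Unset Printing Implicit Defensive.

Import Order.TTheory GRing.Theory Num.Theory.
Import numFieldNormedType.Exports.
Local Open Scope classical_set_scope.
Local Open Scope ring_scope.

(** * Gaussian means of hyperbolic functions *)

Section normal_moments.
Context {R : realType}.
Implicit Types s t z : R.
Local Notation mu := (@lebesgue_measure R).

(** The abstract Radon-Nikodym derivative of [normal_prob] is almost everywhere [normal_pdf], since
    both have the same integral over every measurable set. *)
Lemma ge0_integral_normal_prob s (f : measurableTypeR R -> \bar R) :
  measurable_fun setT f -> (forall z, 0 <= f z)%E ->
  (\int[normal_prob 0 s]_z f z =
   \int[mu]_z (f z * (normal_pdf 0 s z)%:E))%E.
Proof.
move=> mf f0.
have dom := @normal_prob_dominates R 0 s.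
rewrite -(Radon_Nikodym_SigmaFinite.change_of_variables dom)//=.
have RNi := Radon_Nikodym_SigmaFinite.f_integrable dom.
apply: ae_eq_integral => //.
- by apply: emeasurable_funM => //; exact: measurable_int RNi.
- by apply: emeasurable_funM => //; apply/measurable_EFinP;
  exact: measurable_normal_pdf.
- apply: ae_eqe_mul2l; apply: integral_ae_eq => //=.
  + by apply/measurable_EFinP; exact: measurable_normal_pdf.
  + by move=> E _ mE; rewrite -Radon_Nikodym_SigmaFinite.f_integral.
Qed.

(** Completing the square turns the integrand into a constant times the Gaussian density centred at
    [t * s ^+ 2]. *)
Lemma normal_mgf s t : s != 0 ->
  (\int[normal_prob 0 s]_z (expR (t * z))%:E = (expR (t ^+ 2 * s ^+ 2 /
    2))%:E)%E.
Proof.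
have mE : measurable_fun [set: R] (EFin \o (fun z => expR (t * z))).
  by apply/measurable_EFinP; apply: measurableT_comp => //;
    exact: mulrl_measurable.
move=> s0; rewrite ge0_integral_normal_prob//.
under eq_integral => z _.
  rewrite -EFinM normal_pdfE//= mulrCA /normal_fun -expRD.
  have -> : t * z + - (z - 0) ^+ 2 / (s ^+ 2 *+ 2) =
      t ^+ 2 * s ^+ 2 / 2 + - (z - t * s ^+ 2) ^+ 2 / (s ^+ 2 *+ 2).
    by rewrite -(mulr_natr (s ^+ 2)); field.
  rewrite expRD mulrCA EFinM.
  have -> : normal_peak s * expR (- (z - t * s ^+ 2) ^+ 2 / (s ^+ 2 *+ 2)) =
      normal_pdf (t * s ^+ 2) s z by rewrite normal_pdfE.
  over.
rewrite ge0_integralZl//=.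
- by rewrite integral_normal_pdf mule1.
- by apply/measurable_EFinP; exact: measurable_normal_pdf.
- by move=> x _; rewrite lee_fin normal_pdf_ge0.
Qed.

Lemma integrable_expR_normal s t : s != 0 ->
  (normal_prob 0 s).-integrable setT (EFin \o (fun z => expR (t * z))).
Proof.
move=> s0; apply/integrableP; split.
  by apply/measurable_EFinP; apply: measurableT_comp => //;
    exact: mulrl_measurable.
under eq_integral do rewrite /= ger0_norm ?expR_ge0//.
by rewrite normal_mgf// ltry.
Qed.

Lemma integrable_cosh_normal s t : s != 0 ->
  (normal_prob 0 s).-integrable setT (EFin \o (fun z => cosh (t * z))).
Proof.
move=> s0.
have -> : EFin \o (fun z => cosh (t * z)) =
    (fun z => (2^-1)%:E * ((EFin \o (fun z => expR (t * z))) z + (EFin \o (fun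
      z => expR (- t * z))) z))%E.
  by apply/funext => z; rewrite /= -EFinD -EFinM /cosh mulrC mulNr.
by apply: integrableZl => //; apply: integrableD => //;
  exact: integrable_expR_normal.
Qed.

Lemma integrable_sinh_normal s t : s != 0 ->
  (normal_prob 0 s).-integrable setT (EFin \o (fun z => sinh (t * z))).
Proof.
move=> s0.
have -> : EFin \o (fun z => sinh (t * z)) =
    (fun z => (2^-1)%:E * ((EFin \o (fun z => expR (t * z))) z - (EFin \o (fun
      z => expR (- t * z))) z))%E.
  by apply/funext => z; rewrite /= -EFinB -EFinM /sinh mulrC mulNr.
by apply: integrableZl => //; apply: integrableB => //;
  exact: integrable_expR_normal.
Qed.

Lemma Rintegral_cosh_normal s t : s != 0 ->
  \int[normal_prob 0 s]_z cosh (t * z) = expR (t ^+ 2 * s ^+ 2 / 2).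
Proof.
move=> s0; have i1 := @integrable_expR_normal s t s0.
have i2 := @integrable_expR_normal s (- t) s0.
transitivity (\int[normal_prob 0 s]_z ((expR (t * z) + expR (- t * z)) / 2)).
  by apply: eq_Rintegral => z _; rewrite /cosh mulNr.
rewrite RintegralZr//; last by have := integrableD measurableT i1 i2.
rewrite RintegralD// /Rintegral !normal_mgf//= sqrrN; lra.
Qed.

Lemma Rintegral_sinh_normal s t : s != 0 ->
  \int[normal_prob 0 s]_z sinh (t * z) = 0.
Proof.
move=> s0; have i1 := @integrable_expR_normal s t s0.
have i2 := @integrable_expR_normal s (- t) s0.
transitivity (\int[normal_prob 0 s]_z ((expR (t * z) - expR (- t * z)) / 2)).
  by apply: eq_Rintegral => z _; rewrite /sinh mulNr.
rewrite RintegralZr//; last by have := integrableB measurableT i1 i2.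
rewrite RintegralB// /Rintegral !normal_mgf//= sqrrN; lra.
Qed.

(** The mean of [sinh] vanishes and that of [cosh] is [expR (s ^+ 2 / 2)]; the pointwise error is
    integrated in the same way. This integrates the expansion of one Euler step. *)
Lemma normal_mean_approx s (H : R -> R) (a p c C k : R) : s != 0 ->
  (normal_prob 0 s).-integrable setT (EFin \o H) ->
  (forall z, `|H z - (a + p * sinh z + c * cosh z)| <= C * cosh (k * z)) ->
  `|\int[normal_prob 0 s]_z H z - (a + c * expR (s ^+ 2 / 2))|
    <= C * expR (k ^+ 2 * s ^+ 2 / 2).
Proof.
move=> s0 iH Hb.
have ic := @integrable_cosh_normal s 1 s0.
have is_ := @integrable_sinh_normal s 1 s0.
have ik := @integrable_cosh_normal s k s0.
have i1 : (normal_prob 0 s).-integrable setT (EFin \o (fun z => c * cosh (1 *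
  z))).
  by have := integrableZl measurableT c ic.
have i2 : (normal_prob 0 s).-integrable setT (EFin \o (fun z => p * sinh (1 *
  z))).
  by have := integrableZl measurableT p is_.
have i3 : (normal_prob 0 s).-integrable setT (EFin \o (fun z : R => a)).
  by apply: finite_measure_integrable_cst.
have i4 : (normal_prob 0 s).-integrable setT (EFin \o (fun z : R => a + p *
  sinh (1 * z))).
  by have := integrableD measurableT i3 i2.
have i5 : (normal_prob 0 s).-integrable setT (EFin \o (fun z : R => a + p *
  sinh (1 * z) + c * cosh (1 * z))).
  by have := integrableD measurableT i4 i1.
have i6 : (normal_prob 0 s).-integrable setT (EFin \o (fun z : R => H z - (a +
  p * sinh (1 * z) + c * cosh (1 * z)))).
  by have := integrableB measurableT iH i5.
have -> : a + c * expR (s ^+ 2 / 2) =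
    \int[normal_prob 0 s]_z (a + p * sinh (1 * z) + c * cosh (1 * z)).
  rewrite RintegralD// RintegralD// !RintegralZl// Rintegral_sinh_normal//.
  rewrite Rintegral_cosh_normal// Rintegral_cst// expr1n mul1r mulr0 addr0.
  rewrite -[X in X + _ = _]mulr1; congr (_ * _ + _).
  by apply/esym; exact: (congr1 fine (probability_setT (normal_prob 0 s))).
rewrite -RintegralB//.
apply: le_trans (le_normr_Rintegral measurableT i6) _.
rewrite -Rintegral_cosh_normal// -RintegralZl//.
apply: le_Rintegral => //.
- have := integrable_norm i6; rewrite /=.
  by apply: eq_integrable => // x _ /=.
- by have := integrableZl measurableT C ik.
- by move=> z _; rewrite /= mul1r.
Qed.

End normal_moments.

(** * Averaging over an independent increment *)

Section independent_pair.
Context {R : realType} {dT : measure_display} {T : measurableType dT}.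
Variable P : probability T R.

(** Factorization on rectangles identifies the joint law of [(Z, X)] with a product measure, whose
    value on [E] is the integral of the measures of its sections. *)
Lemma independent_pair_law (Q : probability (measurableTypeR R) R)
    (X Z : T -> measurableTypeR R) (E : set (measurableTypeR R *
      measurableTypeR R)) :
  measurable_fun setT X -> measurable_fun setT Z ->
  (forall A B, measurable A -> measurable B ->
    P (Z @^-1` A `&` X @^-1` B) = (Q A * P (X @^-1` B))%E) ->
  measurable E ->
  P [set w | E (Z w, X w)] = (\int[Q]_z P [set w | E (z, X w)])%E.
Proof.
move=> mX mZ indep mE.
pose fX : {mfun T >-> measurableTypeR R} :=
  MeasurableFun.Pack (MeasurableFun.Class (isMeasurableFun.Build _ _ _ _ X mX)).
have mZX : measurable_fun setT (fun w => (Z w, X w)).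
  exact: measurable_fun_pair.
pose fZX : {mfun T >-> (measurableTypeR R * measurableTypeR R)%type} :=
  MeasurableFun.Pack (MeasurableFun.Class (isMeasurableFun.Build _ _ _ _ _
    mZX)).
have := @product_measure_unique _ _ _ _ R Q (distribution P fX)
  (distribution P fZX).
move=> /(_ indep E mE) QE; transitivity (distribution P fZX E) => //.
by rewrite -QE; apply: eq_integral => z _; rewrite /= xsectionE.
Qed.

End independent_pair.

Section cdf_kernel.
Context {R : realType} {dT : measure_display} {T : measurableType dT}.
Variable P : probability T R.

Lemma bounded_integrable_prob (Q : probability (measurableTypeR R) R)
    (f : R -> R) (M : R) : measurable_fun setT f -> (forall x, `|f x| <= M) ->
  Q.-integrable setT (EFin \o f).
Proof.
move=> mf fM; apply: measurable_bounded_integrable => //.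
  by rewrite (le_lt_trans (probability_le1 Q _))// ltry.
exists M; split; first exact: num_real.
by move=> x Mx z _ /=; rewrite (le_trans (fM z))// ltW.
Qed.

(** By independence the new distribution function is the [Q]-average of the old one at [U (y - z)],
    and averaging against a probability does not increase a uniform distance. For an Euler step, [U]
    is the inverse of the deterministic part and [Z] the noise. *)
Lemma cdf_kernel_step (Q : probability (measurableTypeR R) R) (X Z : T -> R)
    (U Phi : R -> R) (e M y : R) :
  measurable_fun setT X -> measurable_fun setT Z ->
  (forall A B, measurable A -> measurable B ->
    P (Z @^-1` A `&` X @^-1` B) = (Q A * P (X @^-1` B))%E) ->
  measurable_fun setT U -> measurable_fun setT Phi ->
  (forall x, `|Phi x| <= M) ->
  (forall x, `|fine (P [set w | X w <= x]) - Phi x| <= e) ->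
  `|fine (P [set w | X w <= U (y - Z w)]) - \int[Q]_z Phi (U (y - z))| <= e.
Proof.
move=> mX mZ indep mU mPhi PhiM Xe.
have mUy : measurable_fun [set: R] (fun z => U (y - z)).
  by apply: measurableT_comp => //; apply: measurable_funB.
pose E : set (measurableTypeR R * measurableTypeR R) := [set p | p.2 <= U (y -
  p.1)].
have mE : measurable E.
  rewrite (_ : E = (fun p : measurableTypeR R * measurableTypeR R => p.2 - U (y
    - p.1)) @^-1` `]-oo, 0]); last first.
    by apply/seteqP; split=> p; rewrite /E /= in_itv/= subr_le0.
  have m2 : measurable_fun [set: measurableTypeR R * measurableTypeR R] (fun p
    => p.2 : R).
    exact: measurable_snd.
  have m1 : measurable_fun [set: measurableTypeR R * measurableTypeR R] (fun p
    => U (y - p.1)).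
    by apply: (measurableT_comp mUy); exact: measurable_fst.
  by rewrite -[X in measurable X]setTI; apply: (measurable_funB m2 m1).
have mXx a : measurable [set w | X w <= a].
  rewrite (_ : [set w | _] = X @^-1` `]-oo, a]); last first.
    by apply/seteqP; split=> w /=; rewrite in_itv.
  by rewrite -[X in measurable X]setTI; exact: mX.
have mG : measurable_fun [set: R] (fun x => fine (P [set w | X w <= x])).
  apply: nondecreasing_measurable => // x x' xx'.
  have sub : [set w | X w <= x] `<=` [set w | X w <= x'].
    by move=> w /= /le_trans; apply.
  by apply: fine_le; rewrite ?fin_num_measure//; apply: le_measure;
    rewrite ?inE.
have iG : Q.-integrable setT (EFin \o (fun z => fine (P [set w | X w <= U (y -
  z)]))).
  apply: (@bounded_integrable_prob _ _ 1); first exact: (measurableT_comp mG).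
  move=> z; rewrite ger0_norm ?fine_ge0//.
  by rewrite -lee_fin fineK ?fin_num_measure// probability_le1.
have iPhi : Q.-integrable setT (EFin \o (fun z => Phi (U (y - z)))).
  by apply: (@bounded_integrable_prob _ _ M) => //;
    exact: (measurableT_comp mPhi).
have -> : fine (P [set w | X w <= U (y - Z w)]) =
    \int[Q]_z fine (P [set w | X w <= U (y - z)]).
  have := @independent_pair_law _ _ _ P Q X Z E mX mZ indep mE.
  rewrite /E /= => ->; rewrite /Rintegral; congr fine.
  apply: eq_integral => z _; rewrite fineK// fin_num_measure//; exact: mXx.
rewrite -RintegralB//.
have iD : Q.-integrable setT (EFin \o (fun z => fine (P [set w | X w <= U (y -
  z)]) - Phi (U (y - z)))).
  by have := integrableB measurableT iG iPhi.
apply: le_trans (le_normr_Rintegral measurableT iD) _.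
have -> : e = \int[Q]_z e.
  rewrite Rintegral_cst// -[LHS]mulr1; congr (_ * _).
  by apply/esym; exact: (congr1 fine (probability_setT Q)).
apply: le_Rintegral => //.
- have := integrable_norm iD; rewrite /=.
  by apply: eq_integrable => // x _ /=.
- exact: finite_measure_integrable_cst.
Qed.

End cdf_kernel.

(** * Mean value estimates and hyperbolic functions *)

Section mean_value.
Context {R : realType}.

Lemma is_derive_continuous (f : R -> R) (x a : R) :
  is_derive x 1 f a -> {for x, continuous f}.
Proof. by move=> df; exact/differentiable_continuous/derivable1_diffP. Qed.

Lemma mean_value_segment (f f' : R -> R) (x y M : R) : x <= y ->
  (forall u, x <= u <= y -> is_derive u 1 f (f' u)) ->
  (forall u, x <= u <= y -> `|f' u| <= M) ->
  `|f y - f x| <= M * (y - x).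
Proof.
rewrite le_eqVlt => /predU1P[->|xy] df f'M;
  first by rewrite !subrr normr0 mulr0.
have [||c /subset_itv_oo_cc cxy ->] := @MVT R f f' x y xy.
- by move=> c /subset_itv_oo_cc; rewrite /= in_itv/=; exact: df.
- apply: continuous_in_subspaceT => c; rewrite inE /= in_itv/= => cxy.
  by apply: is_derive_continuous; exact: df.
rewrite normrM (@ger0_norm _ (y - x)) ?subr_ge0 ?(ltW xy)//.
by rewrite ler_wpM2r ?subr_ge0 ?(ltW xy)// f'M.
Qed.

(** The hypotheses range over the whole ball around [y], which covers both orders of [x] and [y] and
    suits bounds that depend on the distance to [y] only. *)
Lemma mean_value_bound (f f' : R -> R) (x y M : R) :
  (forall u, `|u - y| <= `|x - y| -> is_derive u 1 f (f' u)) ->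
  (forall u, `|u - y| <= `|x - y| -> `|f' u| <= M) ->
  `|f x - f y| <= M * `|x - y|.
Proof.
move=> df f'M; have [xy|yx] := leP x y.
  have dc u : x <= u <= y -> `|u - y| <= `|x - y|.
    by move=> /andP[xu uy]; rewrite !ler0_norm ?subr_le0// lerN2 lerD2r.
  rewrite distrC (distrC x) (@ger0_norm _ (y - x)) ?subr_ge0//.
  by apply: mean_value_segment => // u /dc; [exact: df|exact: f'M].
have dc u : y <= u <= x -> `|u - y| <= `|x - y|.
  by move=> /andP[yu ux]; rewrite !ger0_norm ?subr_ge0 ?(ltW yx)// lerD2r.
rewrite (@ger0_norm _ (x - y)) ?subr_ge0 ?(ltW yx)//.
by apply: mean_value_segment (ltW yx) _ _ => u /dc; [exact: df|exact: f'M].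
Qed.

End mean_value.

Section hyperbolic_facts.
Context {R : realType}.
Implicit Types x y z : R.

Global Instance is_derive_cosh x : is_derive x 1 (@cosh R) (sinh x).
Proof.
rewrite /cosh /sinh.
have -> : (fun x => (expR x + expR (- x)) / 2) =
    2^-1 *: (expR + (expR \o -%R)) :> (R -> R).
  by apply/funext => u; rewrite /= !fctE /= mulrC.
by apply: is_derive_eq; rewrite /GRing.scale /=; lra.
Qed.

Global Instance is_derive_sinh x : is_derive x 1 (@sinh R) (cosh x).
Proof.
rewrite /cosh /sinh.
have -> : (fun x => (expR x - expR (- x)) / 2) =
    2^-1 *: (expR - (expR \o -%R)) :> (R -> R).
  by apply/funext => u; rewrite /= !fctE /= mulrC.
by apply: is_derive_eq; rewrite /GRing.scale /=; lra.
Qed.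

Lemma cosh0 : cosh 0 = 1 :> R.
Proof. by rewrite /cosh oppr0 expR0; lra. Qed.

Lemma sinh0 : sinh 0 = 0 :> R.
Proof. by rewrite /sinh oppr0 subrr mul0r. Qed.

Lemma coshN x : cosh (- x) = cosh x.
Proof. by rewrite /cosh opprK addrC. Qed.

Lemma cosh_abs x : cosh `|x| = cosh x.
Proof. by case: ger0P => // _; rewrite coshN. Qed.

Lemma cosh_gt0 x : 0 < cosh x.
Proof. by rewrite /cosh divr_gt0// addr_gt0// expR_gt0. Qed.

Lemma cosh2Bsinh2 x : cosh x ^+ 2 - sinh x ^+ 2 = 1.
Proof.
have := expRxMexpNx_1 x; rewrite /cosh /sinh => e.
transitivity (expR x * expR (- x)) => //; by field.
Qed.

Lemma cosh_ge1 x : 1 <= cosh x.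
Proof.
by have := cosh2Bsinh2 x; have := cosh_gt0 x; have := sqr_ge0 (sinh x); nra.
Qed.

Lemma sinh_lt_cosh x : `|sinh x| < cosh x.
Proof.
rewrite /sinh /cosh ltr_norml; have := expR_gt0 x; have := expR_gt0 (- x); lra.
Qed.

Lemma ler_sinh : {mono (@sinh R) : x y / x <= y}.
Proof.
apply: le_mono => x y xy.
by rewrite /sinh ltr_pM2r// ltrB// ltr_expR// ltrN2.
Qed.

Lemma ltr_sinh : {mono (@sinh R) : x y / x < y}.
Proof. exact: leW_mono ler_sinh. Qed.

Lemma sinh_gt0 x : 0 < x -> 0 < sinh x.
Proof. by move=> x0; rewrite -sinh0 ltr_sinh. Qed.

Lemma ltr_cosh x y : 0 <= x -> x < y -> cosh x < cosh y.
Proof.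
move=> x0 xy; have := ltr_sinh x y; rewrite xy => sxy.
have sx : 0 <= sinh x.
  by move: x0; rewrite le_eqVlt => /predU1P[<-|/sinh_gt0/ltW//]; rewrite sinh0.
have := cosh2Bsinh2 x; have := cosh2Bsinh2 y.
by have := cosh_gt0 x; have := cosh_gt0 y; nra.
Qed.

Lemma ler_cosh x y : `|x| <= `|y| -> cosh x <= cosh y.
Proof.
rewrite -(cosh_abs x) -(cosh_abs y) le_eqVlt => /predU1P[->//|xy].
by rewrite ltW// ltr_cosh.
Qed.

Lemma cosh_double x : cosh (2 * x) = 2 * cosh x ^+ 2 - 1.
Proof.
have := expRxMexpNx_1 x.
rewrite /cosh (_ : 2 * x = x + x); [|by ring]; rewrite opprD !expRD => e.
transitivity ((expR x * expR x + expR (- x) * expR (- x)) / 2 +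
  (expR x * expR (- x) - 1)); [by rewrite e; ring|by field].
Qed.

(** First of four Taylor bounds at 0. Each remainder is the derivative of the next one, so the mean
    value bound adds a factor of the absolute value of [x] each time; factorials are dropped. *)
Lemma sinh_le_mulcosh x : `|sinh x| <= `|x| * cosh x.
Proof.
have := @mean_value_bound R sinh cosh x 0 (cosh x) _ _.
rewrite sinh0 !subr0 mulrC; apply => u.
by rewrite !subr0 => ux; rewrite ger0_norm ?(ltW (cosh_gt0 _))// ler_cosh.
Qed.

Lemma coshB1_le x : `|cosh x - 1| <= `|x| ^+ 2 * cosh x.
Proof.
have := @mean_value_bound R cosh sinh x 0 (`|x| * cosh x) _ _.
rewrite cosh0 !subr0 mulrAC expr2; apply => u.
rewrite !subr0 => ux; rewrite (le_trans (sinh_le_mulcosh _))//.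
by rewrite ler_pM// ?ler_cosh// (ltW (cosh_gt0 _)).
Qed.

Lemma sinhBid_le x : `|sinh x - x| <= `|x| ^+ 3 * cosh x.
Proof.
have -> : `|x| ^+ 3 * cosh x = `|x| ^+ 2 * cosh x * `|x - 0|.
  by rewrite subr0; ring.
have -> : sinh x - x = (sinh - id) x - (sinh - id) 0.
  by rewrite !fctE /= sinh0 !subr0.
apply: (@mean_value_bound R _ (fun u => cosh u - 1)) => // u.
rewrite !subr0 => ux; rewrite (le_trans (coshB1_le _))//.
by rewrite ler_pM ?exprn_ge0// ?lerXn2r ?nnegrE// ?ler_cosh// (ltW (cosh_gt0
  _)).
Qed.

Lemma cosh_taylor2 x : `|cosh x - 1 - x ^+ 2 / 2| <= `|x| ^+ 4 * cosh x.
Proof.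
pose f : R -> R := cosh - cst 1 - 2^-1 *: (id ^+ 2).
have -> : `|x| ^+ 4 * cosh x = `|x| ^+ 3 * cosh x * `|x - 0|.
  by rewrite subr0; ring.
have -> : cosh x - 1 - x ^+ 2 / 2 = f x - f 0.
  by rewrite /f !fctE /= cosh0 /GRing.scale /=; ring.
apply: (@mean_value_bound R _ (fun u => sinh u - u)) => [u _|u].
  by apply: is_derive_eq; rewrite /GRing.scale/=; field.
rewrite !subr0 => ux; rewrite (le_trans (sinhBid_le _))//.
by rewrite ler_pM ?exprn_ge0// ?lerXn2r ?nnegrE// ?ler_cosh// (ltW (cosh_gt0
  _)).
Qed.

(** A single term of the exponential series is at most the exponential, itself at most [2 * cosh x].
    Powers of the Gaussian variable are absorbed into [cosh] in this way. *)
Lemma exprn_le_cosh n x : `|x| ^+ n.+1 <= n.+1`!%:R * 2 * cosh x.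
Proof.
have h1 := @expR_ge1Dxn R `|x| n (normr_ge0 x).
have f0 : 0 < (n.+1`!)%:R :> R by rewrite ltr0n fact_gt0.
have h2 : expR `|x| <= 2 * cosh x.
  by rewrite -(cosh_abs x) /cosh mulrCA divff// mulr1 lerDl expR_ge0.
have : `|x| ^+ n.+1 / (n.+1)`!%:R <= 2 * cosh x.
  by rewrite (le_trans _ h2)// (le_trans _ h1)// lerDr.
by rewrite ler_pdivrMr// mulrC mulrA.
Qed.

End hyperbolic_facts.

(** * The Euler scheme *)

Section euler_step.
Context {R : realType}.

(** [density_derive] is the stationary Fokker-Planck equation of [dX = b(X) dt + dW] with zero flux.
    [Phi] plays the role of an invariant distribution function, but neither normalization nor
    monotonicity is required. *)
Record drift_cdf (b Phi rho : R -> R) (B L M : R) : Prop := DriftCdf {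
  drift_bounded : forall x, `|b x| <= B ;
  drift_lipschitz : forall x y, `|b x - b y| <= L * `|x - y| ;
  cdf_derive : forall x : R, is_derive x 1 Phi (rho x) ;
  density_derive : forall x : R, is_derive x 1 rho (2 * b x * rho x) ;
  density_bounded : forall x, `|rho x| <= M ;
  cdf_bounded : forall x, `|Phi x| <= M }.

Section taylor.
Context (b Phi rho : R -> R) (B L M : R).
Context (D : drift_cdf b Phi rho B L M).

(** The second derivative of [Phi]. *)
Let q x := 2 * b x * rho x.

Let B0 : 0 <= B. Proof. exact: le_trans (normr_ge0 _) (drift_bounded D 0). Qed.
Let M0 : 0 <= M. Proof. exact: le_trans (normr_ge0 _) (density_bounded D 0).
  Qed.

Lemma flux_bounded x : `|q x| <= 2 * B * M.
Proof.
rewrite /q !normrM (ger0_norm (ler0n _ _)) ler_pM//.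
- by rewrite ler_wpM2l// (drift_bounded D).
- exact: density_bounded D _.
Qed.

Lemma density_lipschitz x y : `|rho x - rho y| <= 2 * B * M * `|x - y|.
Proof.
apply: (@mean_value_bound R _ q) => u _; last exact: flux_bounded.
exact: (density_derive D).
Qed.

(** A frozen drift is Lipschitz but may have a kink, so this Lipschitz constant replaces a bound on
    the third derivative of [Phi]. *)
Lemma flux_lipschitz x y :
  `|q x - q y| <= 2 * M * (2 * B ^+ 2 + L) * `|x - y|.
Proof.
have -> : q x - q y = 2 * b x * (rho x - rho y) + 2 * rho y * (b x - b y).
  by rewrite /q; ring.
have -> : 2 * M * (2 * B ^+ 2 + L) * `|x - y| =
    2 * B * (2 * B * M * `|x - y|) + 2 * M * (L * `|x - y|) by ring.
rewrite (le_trans (ler_normD _ _))// lerD// !normrM (ger0_norm (ler0n _ _)).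
  rewrite ler_pM ?mulr_ge0//; first by rewrite ler_wpM2l// (drift_bounded D).
  exact: density_lipschitz.
rewrite ler_pM ?mulr_ge0//; first by rewrite ler_wpM2l// (density_bounded D).
exact: (drift_lipschitz D).
Qed.

Lemma cdf_taylor1 x y :
  `|Phi x - Phi y - rho y * (x - y)| <= 2 * B * M * `|x - y| ^+ 2.
Proof.
pose f := Phi - rho y *: id.
have -> : Phi x - Phi y - rho y * (x - y) = f x - f y.
  by rewrite /f !fctE /GRing.scale/=; ring.
rewrite [`|x - y| ^+ 2]expr2 mulrA;
  apply: (@mean_value_bound R _ (fun u => rho u - rho y)) => u uxy.
  have := cdf_derive D u => ?.
  by apply: is_derive_eq; rewrite /GRing.scale/= mulr1.
rewrite (le_trans (density_lipschitz _ _))// ler_wpM2l//.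
by rewrite !mulr_ge0.
Qed.

Lemma density_taylor1 x y : 0 <= L ->
  `|rho x - rho y - q y * (x - y)| <= 2 * M * (2 * B ^+ 2 + L) * `|x - y| ^+ 2.
Proof.
move=> L0; pose f := rho - q y *: id.
have -> : rho x - rho y - q y * (x - y) = f x - f y.
  by rewrite /f !fctE /GRing.scale/=; ring.
rewrite [`|x - y| ^+ 2]expr2 mulrA;
  apply: (@mean_value_bound R _ (fun u => q u - q y)) => u uxy.
  have := density_derive D u => ?.
  by apply: is_derive_eq; rewrite /GRing.scale/= mulr1.
rewrite (le_trans (flux_lipschitz _ _))// ler_wpM2l//.
by rewrite !mulr_ge0// addr_ge0// mulr_ge0// exprn_ge0.
Qed.

Lemma cdf_taylor2 x y : 0 <= L ->
  `|Phi x - Phi y - rho y * (x - y) - q y / 2 * (x - y) ^+ 2|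
    <= 2 * M * (2 * B ^+ 2 + L) * `|x - y| ^+ 3.
Proof.
move=> L0; pose f : R -> R := Phi - rho y *: id - q y / 2 *: ((id - cst y) ^+
  2).
have -> : Phi x - Phi y - rho y * (x - y) - q y / 2 * (x - y) ^+ 2 = f x - f y.
  by rewrite /f !fctE /GRing.scale/=; ring.
rewrite [`|x - y| ^+ 3]exprSr mulrA.
apply: (@mean_value_bound R _ (fun u => rho u - rho y - q y * (u - y))) => u
  uxy.
  have := cdf_derive D u => ?.
  by apply: is_derive_eq; rewrite /GRing.scale/= !fctE/=; field.
rewrite (le_trans (density_taylor1 _ _ _))// ler_wpM2l//.
  by rewrite !mulr_ge0// addr_ge0// mulr_ge0// exprn_ge0.
by rewrite lerXn2r ?nnegrE.
Qed.

(** Sum of the coefficients of the six error terms [e1] to [e6] below; 26 is 24 from [e3] plus 2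
    from [e4]. *)
Let C := 2 * B ^+ 3 * M + M * L * B + 26 * (M * (2 * B ^+ 2 + L)) + 12 * M
  + 96 * (B * M).

(* The expansion is in [sinh z] and [cosh z] instead of [z] and [z ^+ 2 / 2]:
   their Gaussian means are exponentials. *)
Lemma euler_step_pointwise h x z y : 0 <= L -> 0 < h -> h <= 1 ->
  x + h * b x = y - z ->
  `|Phi x - (Phi y - q y - h / 2 * q y + - rho y * sinh z + q y * cosh z)|
    <= h * Num.sqrt h * C * cosh (2 / Num.sqrt h * z).
Proof.
move=> L0 h0 h1 xE; set s := Num.sqrt h; set y' := y - z in xE.
have s0 : 0 < s by rewrite sqrtr_gt0.
have hE : h = s ^+ 2 by rewrite sqr_sqrtr// ltW.
have s1 : s <= 1 by rewrite -sqrtr1 ler_sqrt.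
pose w := z / s; have zE : z = s * w by rewrite /w mulrC divfK// gt_eqF.
(* The doubled argument leaves room for a product of two factors [cosh w]: one from bounding a power
   of [w], the other from a Taylor remainder in [z]. *)
have cE : cosh (2 / s * z) = 2 * cosh w ^+ 2 - 1.
  by rewrite -cosh_double /w mulrAC mulrA.
rewrite cE; set c2 := 2 * _ - 1.
have cw1 := cosh_ge1 w.
have c21 : 1 <= c2 by rewrite /c2; nra.
have c2w : cosh w <= c2 by rewrite /c2; nra.
have c2ww : cosh w * cosh w <= c2 by rewrite /c2; nra.
have zw : `|z| = s * `|w| by rewrite zE normrM (gtr0_norm s0).
have czw : cosh z <= cosh w.
  by apply: ler_cosh; rewrite zw ler_piMl.
have cz0 := cosh_gt0 z.
have w1 : `|w| <= 2 * cosh w by have := exprn_le_cosh 0 w; rewrite expr1 mul1r.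
have b1 : `|z| <= 2 * s * c2.
  by rewrite zw (mulrC 2) -mulrA ler_pM2l// (le_trans w1)// ler_pM2l.
have b3' : `|z| ^+ 3 <= 12 * (h * s) * cosh w.
  have -> : 12 * (h * s) * cosh w = s ^+ 3 * (12 * cosh w) by rewrite hE; ring.
  rewrite zw exprMn ler_wpM2l ?exprn_ge0 ?(ltW s0)//.
  by have := exprn_le_cosh 2 w; rewrite -natrM.
have b4' : `|z| ^+ 4 <= 48 * (h * h) * cosh w.
  have -> : 48 * (h * h) * cosh w = s ^+ 4 * (48 * cosh w) by rewrite hE; ring.
  rewrite zw exprMn ler_wpM2l ?exprn_ge0 ?(ltW s0)//.
  by have := exprn_le_cosh 3 w; rewrite -natrM.
have hs0 : 0 <= h * s by rewrite mulr_ge0// ltW.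
have hh : h * h <= h * s by rewrite ler_pM2l// hE expr2 ler_piMl// ltW.
have b3 : `|z| ^+ 3 <= 12 * (h * s) * c2.
  by rewrite (le_trans b3')//; have := ler_wpM2l hs0 c2w; lra.
have b3c : `|z| ^+ 3 * cosh z <= 12 * (h * s) * c2.
  rewrite (le_trans (ler_pM _ _ b3' czw)) ?exprn_ge0 ?(ltW cz0)//.
  by have := ler_wpM2l hs0 c2ww; lra.
have b4c : `|z| ^+ 4 * cosh z <= 48 * (h * s) * c2.
  rewrite (le_trans (ler_pM _ _ b4' czw)) ?exprn_ge0 ?(ltW cz0)//.
  have h00 : 0 <= h * h by rewrite mulr_ge0 ?ltW.
  have := ler_wpM2l h00 c2ww; have := ler_wpM2r (le_trans ler01 c21) hh; lra.
have hc : h * h <= h * s * c2 by rewrite (le_trans hh)// ler_peMr.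
have xy' : x - y' = - (h * b x) by rewrite -xE; ring.
(* Splitting of the error: [e1] moves from [x] to [y']; [e2] evaluates the drift at [y'], where
   [h * b y' * rho y'] is [h / 2 * q y']; [e3] moves from [y'] to [y]; [e4] replaces [q y'] by
   [q y]; [e5] and [e6] replace [z] and [z ^+ 2 / 2] by [sinh z] and [cosh z - 1]. *)
have e1 : `|Phi x - Phi y' + h * b x * rho y'| <= 2 * B ^+ 3 * M * (h * s * c2).
  have := cdf_taylor1 x y'; rewrite xy' mulrN opprK (mulrC (rho y')) =>
    /le_trans; apply.
  have -> : 2 * B ^+ 3 * M * (h * s * c2) = 2 * B * M * (B ^+ 2 * (h * s * c2))
    by ring.
  have bB2 : `|b x| ^+ 2 <= B ^+ 2 by rewrite lerXn2r ?nnegrE// (drift_bounded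
    D).
  rewrite ler_wpM2l ?mulr_ge0// normrN normrM (gtr0_norm h0) exprMn.
  have := ler_wpM2l (exprn_ge0 2 (ltW h0)) bB2.
  have := ler_wpM2l (exprn_ge0 2 B0) hc; lra.
have e2 : `|h * rho y' * (b x - b y')| <= M * L * B * (h * s * c2).
  rewrite 2!normrM (gtr0_norm h0).
  have bb : `|b x - b y'| <= L * (h * B).
    rewrite (le_trans (drift_lipschitz D _ _))// ler_wpM2l//.
    by rewrite xy' normrN normrM (gtr0_norm h0) ler_pM2l// (drift_bounded D).
  have -> : M * L * B * (h * s * c2) = M * L * B * (h * s * c2 - h * h) + h * M
    * (L * (h * B)) by ring.
  rewrite ler_wpDl ?mulr_ge0 ?subr_ge0//.
  by rewrite ler_pM ?mulr_ge0 ?(ltW h0)// ler_pM2l// (density_bounded D).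
have e3 : `|Phi y' - Phi y + rho y * z - q y / 2 * z ^+ 2| <= 24 * (M * (2 * B
  ^+ 2 + L)) * (h * s * c2).
  have := cdf_taylor2 y' y L0.
  have -> : y' - y = - z by rewrite /y'; ring.
  rewrite mulrN opprK sqrrN normrN => /le_trans; apply.
  have -> : 24 * (M * (2 * B ^+ 2 + L)) * (h * s * c2) =
    2 * M * (2 * B ^+ 2 + L) * (12 * (h * s) * c2) by ring.
  by rewrite ler_wpM2l// !mulr_ge0// addr_ge0// mulr_ge0// exprn_ge0.
have e4 : `|h / 2 * (q y' - q y)| <= 2 * (M * (2 * B ^+ 2 + L)) * (h * s * c2).
  rewrite normrM ger0_norm ?divr_ge0 ?(ltW h0)//.
  rewrite (le_trans (ler_wpM2l _ (flux_lipschitz _ _))) ?divr_ge0 ?(ltW h0)//.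
  have -> : y' - y = - z by rewrite /y'; ring.
  rewrite normrN.
  have -> : h / 2 * (2 * M * (2 * B ^+ 2 + L) * `|z|) = h * (M * (2 * B ^+ 2 +
    L)) * `|z| by field.
  have -> : 2 * (M * (2 * B ^+ 2 + L)) * (h * s * c2) = h * (M * (2 * B ^+ 2 +
    L)) * (2 * s * c2) by ring.
  rewrite ler_wpM2l// !mulr_ge0 ?(ltW h0)//.
  by rewrite addr_ge0// mulr_ge0// exprn_ge0.
have e5 : `|rho y * (sinh z - z)| <= 12 * M * (h * s * c2).
  rewrite normrM (_ : 12 * M * (h * s * c2) = M * (12 * (h * s) * c2));
    last by ring.
  by rewrite ler_pM// ?(density_bounded D)// (le_trans (sinhBid_le _)).
have e6 : `|q y * (cosh z - 1 - z ^+ 2 / 2)| <= 96 * (B * M) * (h * s * c2).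
  rewrite normrM (_ : 96 * (B * M) * (h * s * c2) = 2 * B * M * (48 * (h * s) *
    c2)); last by ring.
  by rewrite ler_pM// ?flux_bounded// (le_trans (cosh_taylor2 _)).
have -> : Phi x - (Phi y - q y - h / 2 * q y + - rho y * sinh z + q y * cosh z)
  =
   (Phi x - Phi y' + h * b x * rho y') - h * rho y' * (b x - b y')
   + (Phi y' - Phi y + rho y * z - q y / 2 * z ^+ 2) - h / 2 * (q y' - q y)
   + rho y * (sinh z - z) - q y * (cosh z - 1 - z ^+ 2 / 2).
  by rewrite /q; field.
have -> : h * s * C * c2 = 2 * B ^+ 3 * M * (h * s * c2) + M * L * B * (h * s *
  c2)
  + 24 * (M * (2 * B ^+ 2 + L)) * (h * s * c2) + 2 * (M * (2 * B ^+ 2 + L)) *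
    (h * s * c2)
  + 12 * M * (h * s * c2) + 96 * (B * M) * (h * s * c2).
  by rewrite /C; ring.
do 5 (rewrite (le_trans (ler_normD _ _))// lerD ?normrN//).
Qed.

(** In the mean of the pointwise expansion the terms of order [h] cancel: the drift contributes
    [- h / 2 * q y] and the Gaussian variance [h / 2 * q y]. The constant [K] serves all steps
    [h <= 1] at once. *)
Lemma cdf_almost_invariant : 0 <= L -> exists K : R, 0 <= K /\ forall (h : R)
  (U : R -> R), 0 < h -> h <= 1 ->
    (forall y, U y + h * b (U y) = y) -> measurable_fun setT U ->
    forall y, `|\int[normal_prob 0 (Num.sqrt h)]_z Phi (U (y - z)) - Phi y|
      <= K * (h * Num.sqrt h).
Proof.
move=> L0; have C0 : 0 <= C.
  by rewrite /C !addr_ge0 ?mulr_ge0 ?addr_ge0 ?mulr_ge0 ?exprn_ge0.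
(* [expR 2] is the mean of [cosh (2 / s * z)]; [2 * B * M] bounds [q y], which multiplies the
   remainder of [expR (h / 2)]. *)
exists (C * expR 2 + 2 * B * M); split.
  by rewrite addr_ge0 ?mulr_ge0 ?expR_ge0.
move=> h U h0 h1 UE mU y; set s := Num.sqrt h.
have s0 : 0 < s by rewrite sqrtr_gt0.
have hE : h = s ^+ 2 by rewrite sqr_sqrtr// ltW.
have s1 : s <= 1 by rewrite -sqrtr1 ler_sqrt.
have hh : h * h <= h * s by rewrite ler_pM2l// hE expr2 ler_piMl// ltW.
have mPhi : measurable_fun setT Phi.
  by apply: continuous_measurable_fun => u;
    exact: is_derive_continuous (cdf_derive D u).
have iH : (normal_prob 0 s).-integrable setT (EFin \o (fun z => Phi (U (y -
  z)))).
  apply: (@bounded_integrable_prob _ _ _ M) => //; last by move=> z;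
    exact: (cdf_bounded D).
  apply: (measurableT_comp mPhi); apply: (measurableT_comp mU).
  exact: measurable_funB.
have := @normal_mean_approx R s _ (Phi y - q y - h / 2 * q y) (- rho y) (q y)
  (h * s * C) (2 / s) (lt0r_neq0 s0) iH
  (fun z => @euler_step_pointwise h (U (y - z)) z y L0 h0 h1 (UE _)).
have -> : (2 / s) ^+ 2 * s ^+ 2 / 2 = 2 by field; rewrite gt_eqF.
rewrite -hE.
set I := Rintegral _ _ _ => HI.
have e2 : `|expR (h / 2) - 1 - h / 2| <= h * h.
  have := expR_ge1Dx (h / 2); have := expR_ge1Dx (- (h / 2)).
  have := expRxMexpNx_1 (h / 2); set E := expR (h / 2);
    set E' := expR (- (h / 2)).
  move=> EE' lE' lE; have E0 : 0 < E by exact: expR_gt0.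
  have h3 : E * (1 - h / 2) <= 1 by have := ler_wpM2l (ltW E0) lE'; lra.
  rewrite ger0_norm; last by lra.
  by nra.
have e3 : `|q y * (expR (h / 2) - 1 - h / 2)| <= 2 * B * M * (h * s).
  by rewrite normrM ler_pM ?flux_bounded// (le_trans e2).
have -> : I - Phi y = (I - (Phi y - q y - h / 2 * q y + q y * expR (h / 2)))
   + q y * (expR (h / 2) - 1 - h / 2) by field.
rewrite (le_trans (ler_normD _ _))// mulrDl lerD//.
by rewrite (le_trans HI)//; lra.
Qed.

End taylor.

Lemma lipschitz_bound_continuous (f : R -> R) (L : R) :
  (forall x y, `|f x - f y| <= L * `|x - y|) -> continuous f.
Proof.
move=> fL x; apply/cvgrPdist_le => e e0.
have L1 : 0 < `|L| + 1 by rewrite ltr_wpDl.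
near=> t; rewrite (le_trans (fL _ _))//.
have xt : `|x - t| <= e / (`|L| + 1).
  near: t; apply: (@cvgr_dist_le _ _ _ _ _ id x) => //.
  by rewrite divr_gt0.
have := ler_wpM2l (ltW L1) xt; rewrite mulrCA divff ?gt_eqF// mulr1.
by apply: le_trans; rewrite ler_wpM2r// (le_trans (ler_norm L))// lerDl.
Unshelve. all: by end_near. Qed.

(** [h * L < 1] makes the deterministic part of the step strictly increasing, and the bound on [b]
    places [y] between its values at [y - h * B] and [y + h * B]. The last clause pulls an event on
    the new position back to the old one. *)
Lemma euler_inverse (b : R -> R) (B L h : R) :
  (forall x, `|b x| <= B) -> (forall x y, `|b x - b y| <= L * `|x - y|) ->
  0 <= h -> h * L < 1 ->
  exists U : R -> R, [/\ forall y, U y + h * b (U y) = y,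
    {homo U : y y' / y <= y'} & forall x y, (x + h * b x <= y) = (x <= U y)].
Proof.
move=> bB bL h0 hL.
have T_mono x x' : x < x' -> x + h * b x < x' + h * b x'.
  move=> xx'; have := bL x x'; rewrite ler_norml => /andP[_].
  have xx0 : 0 < x' - x by rewrite subr_gt0.
  rewrite (ltr0_norm (_ : x - x' < 0)) ?subr_lt0// opprB => bxx'.
  have := ler_wpM2l h0 bxx'; rewrite mulrA => h1.
  have : h * L * (x' - x) < 1 * (x' - x) by rewrite ltr_pM2r.
  nra.
have T_cont : continuous (fun x => x + h * b x).
  have bc : continuous b.
    exact: lipschitz_bound_continuous bL.
  move=> x; apply: cvgD; first exact: cvg_id.
  by apply: cvgM; [exact: cvg_cst|exact: bc].
have /choice[U UE] : forall y, exists x, x + h * b x = y.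
  move=> y.
  have B0 : 0 <= B := le_trans (normr_ge0 _) (bB 0).
  have hB : 0 <= h * B by rewrite mulr_ge0.
  have [|||c _ <-] := @IVT R (fun x => x + h * b x) (y - h * B) (y + h * B) y.
  - by lra.
  - exact: continuous_subspaceT.
  - have l1 : y - h * B + h * b (y - h * B) <= y.
      have /ler_normlP[_ /(ler_wpM2l h0)] := bB (y - h * B); lra.
    have l2 : y <= y + h * B + h * b (y + h * B).
      have /ler_normlP[/(ler_wpM2l h0) + _] := bB (y + h * B); lra.
    by rewrite ge_min l1 le_max l2 orbT.
  by exists c.
have U_le x y : (x + h * b x <= y) = (x <= U y).
  rewrite -{1}(UE y).
  exact: (le_mono (fun u v => @T_mono u v)).
exists U; split => // y y' yy'.
by rewrite -U_le UE.
Qed.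

End euler_step.

(** * Stability of the scheme and its distribution functions *)

Section euler_scheme.
Context {R : realType}.

Fixpoint euler_scheme (b : R -> R) (h x0 : R) (w : nat -> R) (n : nat) : R :=
  if n is k.+1 then
    let x := euler_scheme b h x0 w k in x + h * b x + (w k.+1 - w k)
  else x0.

(* Since [b] is nonincreasing, one Euler step is nonexpansive: local errors
   add up without amplification. *)
Lemma euler_scheme_stable (b : R -> R) (L h r : R) (s w : nat -> R) (n : nat) :
  (forall x y, x <= y -> b y <= b x) ->
  (forall x y, `|b x - b y| <= L * `|x - y|) ->
  0 <= h -> h * L <= 1 ->
  (forall k, (k < n)%N ->
    `|s k.+1 - s k - h * b (s k) - (w k.+1 - w k)| <= r) ->
  `|s n - euler_scheme b h (s 0%N) w n| <= n%:R * r.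
Proof.
move=> b_noninc bL h0 hL.
have step x y : `|(x + h * b x) - (y + h * b y)| <= `|x - y|.
  wlog yx : x y / y <= x.
    move=> hwlog; have [/hwlog//|/ltW/hwlog] := leP y x.
    by rewrite distrC (distrC y).
  have d0 : 0 <= x - y by rewrite subr_ge0.
  have b1 := b_noninc _ _ yx.
  have b1' : 0 <= b y - b x by rewrite subr_ge0.
  have b2 := bL y x; move: b2.
  rewrite (ger0_norm b1') (distrC y) (ger0_norm d0) => b2.
  have := ler_wpM2l h0 b2; have := ler_wpM2r d0 hL; have := mulr_ge0 h0 b1'.
  by move=> h1 h2 h3; rewrite ler_norml; apply/andP; split; nra.
elim: n => [_|n IH rn]; first by rewrite subrr normr0 mul0r.
rewrite /= -natr1 mulrDl mul1r.
set x := euler_scheme _ _ _ _ _.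
have -> : s n.+1 - (x + h * b x + (w n.+1 - w n)) =
   (s n + h * b (s n) - (x + h * b x)) +
   (s n.+1 - s n - h * b (s n) - (w n.+1 - w n)) by ring.
rewrite (le_trans (ler_normD _ _))// lerD ?rn// (le_trans (step _ _))//.
by apply: IH => k kn; apply: rn; exact: ltnW.
Qed.

End euler_scheme.

Section euler_cdf.
Context {R : realType} {dT : measure_display} {T : measurableType dT}.
Variable P : probability T R.
Variables (F : R -> set (set T)) (W : R -> T -> R).
Hypotheses (filtF : is_filtration F) (wienerW : is_wiener P F W).

Definition adapted_at (t : R) (X : T -> R) : Prop :=
  forall B, measurable B -> F t (X @^-1` B).

(** Passing to the type of the generated sigma-algebra makes the closure lemmas on measurable
    functions available. Since [F t] is a sigma-algebra, generation adds no set. *)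
Lemma adapted_atP t X : 0 <= t -> adapted_at t X <->
  measurable_fun (setT : set (g_sigma_algebraType (F t))) X.
Proof.
move=> t0; have FE : <<s F t>> = F t.
  exact/sigma_algebra_id/(filtration_sigma_algebra filtF).
split=> [XF _ B mB|mX B mB].
  by rewrite setTI; change (<<s F t >> (X @^-1` B)); rewrite FE; exact: XF.
have := mX measurableT B mB; rewrite setTI.
by change (<<s F t >> (X @^-1` B) -> F t (X @^-1` B)); rewrite FE.
Qed.

Lemma adapted_atW s t X : 0 <= s -> s <= t -> adapted_at s X -> adapted_at t X.
Proof. by move=> s0 st XF B mB;
  apply: (filtration_nondecreasing filtF) st _ _ => //; exact: XF. Qed.

Lemma adapted_at_measurable t X : 0 <= t -> adapted_at t X -> measurable_fun
  setT X.
Proof.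
move=> t0 XF _ B mB; rewrite setTI.
exact: (filtration_measurable filtF t0) (XF _ mB).
Qed.

Lemma wiener_increment_independent s t X : 0 <= s -> s < t -> adapted_at s X ->
  forall A B, measurable A -> measurable B ->
    P ((W t \- W s) @^-1` A `&` X @^-1` B) =
    (normal_prob 0 (Num.sqrt (t - s)) A * P (X @^-1` B))%E.
Proof.
move=> s0 st XF A B mA mB; rewrite setIC.
rewrite (wiener_increment_indep wienerW s0 st) ?(wiener_increment_law
  wienerW)//.
- by rewrite muleC.
- exact: XF.
- by exists A => //; rewrite setTI.
Qed.

Variables (b Phi rho : R -> R) (B L M h : R) (S0 : T -> R).
Hypotheses (D : drift_cdf b Phi rho B L M) (h_gt0 : 0 < h).
Hypothesis S0F : adapted_at 0 S0.

Definition euler_process (n : nat) (w : T) : R :=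
  euler_scheme b h (S0 w) (fun k => W (k%:R * h) w) n.

(** Adaptedness at the grid time makes the scheme independent of the next Wiener increment. *)
Lemma adapted_euler_process n : adapted_at (n%:R * h) (euler_process n).
Proof.
elim: n => [|n IH]; first by rewrite mul0r.
have t0 k : 0 <= k%:R * h by rewrite mulr_ge0// ltW.
have nt : n%:R * h <= n.+1%:R * h by rewrite ler_wpM2r ?ler_nat// ltW.
have /adapted_atP-/(_ (t0 _)) mX := adapted_atW (t0 _) nt IH.
have Wa k : adapted_at (k%:R * h) (W (k%:R * h)).
  by move=> A mA; apply: (wiener_adapted wienerW).
have /adapted_atP-/(_ (t0 _)) mW := Wa n.+1.
have /adapted_atP-/(_ (t0 _)) mW' := adapted_atW (t0 _) nt (Wa n).
have mb : measurable_fun setT b.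
  by apply: continuous_measurable_fun;
    exact: lipschitz_bound_continuous (drift_lipschitz D).
apply/adapted_atP => //; rewrite /euler_process /=.
apply: measurable_funD; last exact: measurable_funB.
apply: measurable_funD => //; apply: measurable_funM => //.
exact: (measurableT_comp mb).
Qed.

(** A step carries the distance to [Phi] over to the mean of [Phi (U (y - z))], which is within [K]
    of [Phi y]; hence each step adds at most [K]. *)
Lemma euler_process_cdf (K e : R) (U : R -> R) :
  {homo U : y y' / y <= y'} ->
  (forall x y, (x + h * b x <= y) = (x <= U y)) ->
  (forall y, `|\int[normal_prob 0 (Num.sqrt h)]_z Phi (U (y - z)) - Phi y| <=
    K) ->
  (forall x, `|fine (P [set w | S0 w <= x]) - Phi x| <= e) ->
  forall n x, `|fine (P [set w | euler_process n w <= x]) - Phi x| <= e + n%:R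
    * K.
Proof.
move=> Und UE UK S0e; elim=> [x|n IH y]; first by rewrite mul0r addr0.
have t0 k : 0 <= k%:R * h by rewrite mulr_ge0// ltW.
have nt : n%:R * h < n.+1%:R * h by rewrite ltr_pM2r// ltr_nat.
have dt : n.+1%:R * h - n%:R * h = h by rewrite -natr1; ring.
pose Z := W (n.+1%:R * h) \- W (n%:R * h).
have Wm k : measurable_fun setT (W (k%:R * h)).
  apply: (@adapted_at_measurable (k%:R * h)) => // A mA.
  exact: (wiener_adapted wienerW).
have mZ : measurable_fun setT Z by exact: measurable_funB.
have mX := adapted_at_measurable (t0 n) (adapted_euler_process n).
have indep := wiener_increment_independent (t0 n) nt (adapted_euler_process n).
rewrite dt in indep.
have mPhi : measurable_fun setT Phi.
  by apply: continuous_measurable_fun => u;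
    exact: is_derive_continuous (cdf_derive D u).
have mU : measurable_fun setT U by exact: nondecreasing_measurable.
have := @cdf_kernel_step _ _ _ P (normal_prob 0 (Num.sqrt h)) _ Z U Phi _ M y
  mX mZ indep mU mPhi (cdf_bounded D) IH.
have -> : [set w | euler_process n.+1 w <= y] =
    [set w | euler_process n w <= U (y - Z w)].
  by apply/seteqP; split => w /=; rewrite -UE /euler_process /= lerBrDr.
move: (UK y); set I := Rintegral _ _ _; set p := fine _ => h1 h2.
rewrite -natr1 mulrDl mul1r; have := ler_normD (p - I) (I - Phi y).
by rewrite subrKA; lra.
Qed.

End euler_cdf.

(** * Convergence along paths and invariance of the law *)

Section path_residual.
Context {R : realType}.
Local Notation mu := (@lebesgue_measure R).

(** Heine's theorem from the covering form of compactness: around each point, half of its continuity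
    radius serves for the ball and the other half for the threshold on [r]. *)
Lemma segment_uniform_continuity (g : R -> R) (a c e : R) :
  {within `[a, c], continuous g} -> 0 < e ->
  exists2 r, 0 < r & forall x y, x \in `[a, c] -> y \in `[a, c] ->
    `|x - y| <= r -> `|g x - g y| <= e.
Proof.
move=> /subspace_continuousP cg e0.
pose Q (r x : R) := x \in `[a, c] -> forall y, y \in `[a, c] ->
  `|x - y| <= r -> `|g x - g y| <= e.
have /compact_near_coveringP/(_ R (0 : R)^'+ Q _) cov := @segment_compact R a c.
have [x Kx|r /= r0 rQ] := cov _.
  have e2 : 0 < e / 2 by rewrite divr_gt0.
  have /cvgrPdist_le/(_ _ e2) := cg x Kx.
  rewrite near_withinE => /nbhs_ballP[rho /= rho0 ball_g].
  exists (ball x (rho / 2), [set r | r < rho / 2]).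
    split => /=; first by apply: nbhsx_ballx; rewrite divr_gt0.
    by apply: nbhs_right_lt; rewrite divr_gt0.
  move=> [x' r] /= [xx' r_rho] Kx' y Ky x'y.
  have gx' : `|g x - g x'| <= e / 2.
    by apply: ball_g => //; apply: le_ball xx'; move: rho0; lra.
  have gy : `|g x - g y| <= e / 2.
    apply: ball_g => //; rewrite /ball /= in xx' *.
    by have := ler_normD (x - x') (x' - y); rewrite subrKA; lra.
  have := ler_normB (g x - g y) (g x - g x').
  by rewrite opprB addrC subrKA distrC; lra.
exists (r / 2); first by rewrite divr_gt0.
move=> x y Kx Ky xy; apply: (rQ (r / 2)) => //=.
- by rewrite sub0r normrN gtr0_norm ?divr_gt0// ltr_pdivrMr// ltr_pMr// ltr1n.
- by rewrite divr_gt0.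
Qed.

(** The noise is additive, so the residual is the integral over one step of [b (f u) - b (f s)] with
    [s] the left end of the step; uniform continuity of [b \o f] on [[0, t]] makes the integrand
    small. Positivity of [f] keeps the path where [b] is continuous. *)
Lemma sde_path_residual (b f w : R -> R) (t d : R) :
  {within `[0, +oo[, continuous f} -> (forall r, 0 <= r -> 0 < f r) ->
  (forall x : R, 0 < x -> {for x, continuous b}) ->
  (forall s, 0 <= s -> f s = f 0 + \int[mu]_(r in `[0, s]) b (f r) + w s) ->
  0 < t -> 0 < d ->
  exists N : nat, forall n, (N <= n)%N -> (0 < n)%N ->
    forall (h : R) k, h = t / n%:R -> (k < n)%N ->
    `|f (k.+1%:R * h) - f (k%:R * h) - h * b (f (k%:R * h))
      - (w (k.+1%:R * h) - w (k%:R * h))| <= d * h.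
Proof.
move=> cf f0 cb fE t0 d0.
have cg : {within `[0, t], continuous (b \o f)}.
  apply/subspace_continuousP => x; rewrite /= in_itv/= => /andP[x0 xt].
  apply: cvg_comp; last exact: (cb _ (f0 _ x0)).
  have /subspace_continuousP/(_ x) := cf.
  rewrite /= in_itv/= andbT => /(_ x0); apply: cvg_trans.
  apply: cvg_app; apply: within_subset => u.
  by rewrite /= !in_itv/= => /andP[->].
have [r r0 gr] := segment_uniform_continuity cg d0.
exists (Num.truncn (t / r)).+1 => n nN n0 h k hE kn.
have nR : 0 < n%:R :> R by rewrite ltr0n.
have h0 : 0 < h by rewrite hE divr_gt0.
have hr : h <= r.
  rewrite hE ler_pdivrMr// mulrC -ler_pdivrMr//.
  by rewrite (le_trans (ltW (truncnS_gt _)))// ler_nat.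
set s := k%:R * h; set s' := k.+1%:R * h.
have s0 : 0 <= s by rewrite mulr_ge0// ltW.
have s'E : s' = s + h by rewrite /s' /s -natr1; ring.
have ss' : s <= s' by rewrite s'E lerDl ltW.
have s't : s' <= t.
  by rewrite /s' hE mulrCA ler_piMr ?(ltW t0)// ler_pdivrMr// mul1r ler_nat.
have gi a c : 0 <= a -> c <= t -> mu.-integrable `[a, c] (EFin \o (b \o f)).
  move=> a0 ct; apply: continuous_compact_integrable;
    first exact: segment_compact.
  apply: continuous_subspaceW cg => u; rewrite /= !in_itv/= => /andP[au uc].
  by rewrite (le_trans a0)// (le_trans uc).
have -> : f s' - f s - h * b (f s) - (w s' - w s) =
    \int[mu]_(u in `[s, s']) (b (f u)) - h * b (f s).
  rewrite (fE s') ?(fE s) ?(le_trans s0)//.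
  have := @Rintegral_itvB R (b \o f) (BLeft 0) (BRight s') s (gi 0 s' (lexx _)
    s't).
  rewrite !bnd_simp => /(_ s0 ss').
  (* The difference of the two integrals omits the left endpoint, a null set. *)
  rewrite Rintegral_itv_obnd_cbnd; last first.
    apply: integrableS (gi 0 s' (lexx _) s't) => //.
    by move=> u; rewrite /= !in_itv/= => /andP[/ltW/(le_trans s0)-> ->].
  by move=> /= <-; ring.
have -> : h * b (f s) = \int[mu]_(u in `[s, s']) (b (f s)).
  rewrite Rintegral_cst//= lebesgue_measure_itv/= lte_fin s'E ltrDl h0/=.
  by rewrite mulrC; congr (_ * _); ring.
have ic (c : R) : mu.-integrable `[s, s'] (EFin \o (fun=> c)).
  apply: continuous_compact_integrable; first exact: segment_compact.
  by apply: continuous_subspaceT => u; exact: cst_continuous.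
have iB : mu.-integrable `[s, s'] (EFin \o (fun u => b (f u) - b (f s))).
  apply: (integrableB _ (gi s s' s0 s't) (ic (b (f s)))) => //.
rewrite -RintegralB//; last exact: (gi s s').
rewrite (le_trans (le_normr_Rintegral _ _))//.
have -> : d * h = \int[mu]_(u in `[s, s']) d.
  rewrite Rintegral_cst//= lebesgue_measure_itv/= lte_fin s'E ltrDl h0/=.
  by congr (_ * _); ring.
apply: le_Rintegral => //; first exact: integrable_norm iB.
move=> u; rewrite /= in_itv/= => /andP[su us'].
apply: gr; rewrite ?in_itv/=.
- by rewrite (le_trans s0)// (le_trans us').
- by rewrite s0 (le_trans ss').
- by rewrite ger0_norm ?subr_ge0// lerBlDl (le_trans us')// s'E lerD2l.
Qed.

End path_residual.

Section eventually.
Context {R : realType} {dT : measure_display} {T : measurableType dT}.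
Variable P : probability T R.

(** The limit superior of the [A n] is a null event, so by continuity from above the probabilities
    of the tail unions [G n] tend to 0. *)
Lemma ae_eventually_probability (A : nat -> set T) (e : R) : 0 < e ->
  (forall n, measurable (A n)) ->
  {ae P, forall w, exists N : nat, forall n, (N <= n)%N -> ~ A n w} ->
  exists N : nat, forall n, (N <= n)%N -> fine (P (A n)) <= e.
Proof.
move=> e0 mA [N0 [mN0 PN0 sub]].
pose G n := \bigcup_(k in [set k | (n <= k)%N]) A k.
have mG n : measurable (G n) by apply: bigcup_measurable => k _; exact: mA.
have mI : measurable (\bigcap_n G n) by exact: bigcap_measurable.
have G0 : P (\bigcap_n G n) = 0%E.
  apply/eqP; rewrite eq_le measure_ge0// andbT -PN0 le_measure ?inE//.
  move=> w Gw; apply: sub => /= -[N NA].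
  by have [k /= Nk Akw] := Gw N I; exact: NA Nk Akw.
have niG : nonincreasing_seq G.
  move=> n m nm; apply/subsetPset => w [k /= mk Akw].
  by exists k => //=; exact: leq_trans mk.
have : P \o G @ \oo --> P (\bigcap_n G n).
  apply: nonincreasing_cvg_mu => //.
  by rewrite (le_lt_trans (probability_le1 P _))// ltry.
rewrite G0 => /fine_cvgP[_] /cvgrPdist_le/(_ _ e0)[N _ NG].
exists N => n Nn; have := NG n Nn; rewrite /= sub0r normrN.
rewrite ger0_norm ?fine_ge0// => /(le_trans _); apply.
apply: fine_le; rewrite ?fin_num_measure//.
by apply: le_measure; rewrite ?inE// => w Aw; exists n => /=.
Qed.

End eventually.

Section invariance.
Context {R : realType} {dT : measure_display} {T : measurableType dT}.
Variable P : probability T R.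

Lemma fine_probability_le3 (A B C D : set T) :
  measurable A -> measurable B -> measurable C -> measurable D ->
  A `<=` B `|` (C `|` D) ->
  fine (P A) <= fine (P B) + (fine (P C) + fine (P D)).
Proof.
move=> mA mB mC mD sub.
have mCD : measurable (C `|` D) by exact: measurableU.
rewrite -lee_fin !EFinD !fineK ?fin_num_measure//.
apply: (@le_trans _ _ (P (B `|` (C `|` D)))).
  by apply: le_measure; rewrite ?inE//; exact: measurableU.
by rewrite (le_trans (measureU2 P mB mCD))// leeD2l// measureU2.
Qed.

(** The open upper half-lines are stable under intersection, generate the Borel sets and exhaust the
    line, so a probability is determined by its values on them. *)
Lemma eq_law (X Y : T -> R) :
  measurable_fun setT X -> measurable_fun setT Y ->
  (forall x, fine (P [set w | X w <= x]) = fine (P [set w | Y w <= x])) ->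
  forall A, measurable A -> P (X @^-1` A) = P (Y @^-1` A).
Proof.
move=> mX mY XY.
pose fX : {mfun T >-> measurableTypeR R} := MeasurableFun.Pack
  (MeasurableFun.Class (isMeasurableFun.Build _ _ T (measurableTypeR R) X mX)).
pose fY : {mfun T >-> measurableTypeR R} := MeasurableFun.Pack
  (MeasurableFun.Class (isMeasurableFun.Build _ _ T (measurableTypeR R) Y mY)).
have Pgt (Z : T -> R) x : measurable_fun setT Z ->
    P (Z @^-1` `]x, +oo[) = (1 - P [set w | (Z w <= x)%R])%E.
  move=> mZ; have -> : Z @^-1` `]x, +oo[ = ~` [set w | (Z w <= x)%R].
    by apply/seteqP; split=> w /=; rewrite in_itv/= andbT ltNge => /negP.
  rewrite probability_setC// (_ : [set w | _] = Z @^-1` `]-oo, x]); last first.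
    by apply/seteqP; split=> w /=; rewrite in_itv.
  by rewrite -[X in measurable X]setTI; exact: mZ.
have mle (Z : T -> R) x : measurable_fun setT Z -> measurable [set w | Z w <=
  x].
  move=> mZ; rewrite (_ : [set w | _] = Z @^-1` `]-oo, x]); last first.
    by apply/seteqP; split=> w /=; rewrite in_itv.
  by rewrite -[X in measurable X]setTI; exact: mZ.
move=> A mA; change (distribution P fX A = distribution P fY A).
apply: (@measure_unique _ R (measurableTypeR R) (@RGenOInfty.G R)
  (fun n => `]- n%:R, +oo[%classic) _ _ _ _
  (distribution P fX) (distribution P fY)) => //.
- exact: RGenOInfty.measurableE.
- move=> _ _ [x ->] [y ->]; exists (Num.max x y).
  by apply/seteqP; split=> u /=; rewrite !in_itv/= !andbT gt_max => /andP.
- by move=> n; exists (- n%:R).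
- apply/seteqP; split=> // u _; exists (Num.truncn `|u|).+1 => //=.
  rewrite in_itv/= andbT ltrNl (le_lt_trans _ (truncnS_gt _))//.
  by rewrite -normrN ler_norm.
- move=> _ [x ->].
  change (P (X @^-1` `]x, +oo[) = P (Y @^-1` `]x, +oo[)); rewrite !Pgt//.
  by rewrite -(fineK (fin_num_measure P _ (mle X x mX))) XY fineK//
    fin_num_measure//; exact: mle.
- by move=> n; rewrite (le_lt_trans (probability_le1 _ _))// ltry.
Qed.

Lemma path_minimum (f : R -> R) (t : R) :
  0 <= t -> {within `[0, +oo[, continuous f} -> (forall r, 0 <= r -> 0 < f r) ->
  exists2 c, 0 < c & forall r, 0 <= r <= t -> c <= f r.
Proof.
move=> t0 cf f0.
have [|c] := @EVT_min R f 0 t t0.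
  apply: continuous_subspaceW cf => u; rewrite /= !in_itv/= => /andP[->//].
rewrite in_itv/= => /andP[c0 ct] fc.
by exists (f c); [exact: f0|move=> r rt; apply: fc; rewrite in_itv].
Qed.

(** The positive minimum of the path on [[0, t]] bounds it on all grids at once, so [N] does not
    depend on the mesh. *)
Lemma grid_infimum_eventually (f : R -> R) (t : R) :
  0 <= t -> {within `[0, +oo[, continuous f} -> (forall r, 0 <= r -> 0 < f r) ->
  exists N : nat, forall m, (N <= m)%N -> forall n k, (k <= n)%N ->
    m.+1%:R^-1 <= f (k%:R * (t / n%:R)).
Proof.
move=> t0 cf f0; have [c c0 fc] := path_minimum t0 cf f0.
exists (Num.truncn c^-1) => m Nm n k kn; apply: (@le_trans _ _ c).
  rewrite invf_ple ?posrE//.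
  by rewrite (le_trans (ltW (truncnS_gt _)))// ler_nat ltnS.
apply: fc; rewrite mulr_ge0 ?divr_ge0//= mulrCA ler_piMr//.
(* For [n = 0] the quotient [t / n%:R] is 0 by convention, and the grid is the single time 0. *)
have [->|n0] := eqVneq n 0%N; first by rewrite invr0 mulr0.
by rewrite ler_pdivrMr ?ltr0n ?lt0n// mul1r ler_nat.
Qed.

Variables (F : R -> set (set T)) (W S : R -> T -> R) (b : R -> R).
Hypotheses (filtF : is_filtration F) (wienerW : is_wiener P F W).
Hypotheses (adaptS : adapted F S) (contS : continuous_paths S).
Hypothesis S_gt0 : forall t w, 0 <= t -> 0 < S t w.
Hypothesis sdeS : {ae P, forall w, forall t, 0 <= t ->
  S t w = S 0 w + \int[lebesgue_measure]_(r in `[0, t]) b (S r w) + W t w}.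
Hypothesis b_cont : forall x : R, 0 < x -> {for x, continuous b}.
Hypothesis b_noninc : forall x y, 0 < x -> x <= y -> b y <= b x.

Let cdf0 x := fine (P [set w | S 0 w <= x]).

(** The choices are made in this order: a level that paths rarely cross on the grids, a freezing
    point [eps] below it together with [Phi], and last the number [n] of Euler steps, whose
    requirements depend on the constants of [Phi]. *)
Lemma cdf_invariant :
  (forall e e0, 0 < e -> 0 < e0 -> exists eps Phi rho B L M,
    [/\ 0 < eps < e0, 0 <= L,
        drift_cdf (fun x => b (Num.max x eps)) Phi rho B L M &
        forall x, `|cdf0 x - Phi x| <= e]) ->
  forall t y, 0 <= t -> fine (P [set w | S t w <= y]) = cdf0 y.
Proof.
move=> approx t y; rewrite le_eqVlt => /predU1P[<-//|t0].
apply/eqP; rewrite -subr_eq0 -normr_le0; apply/ler_addgt0Pl => e e0.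
(* Six errors of at most [eta] occur: two from [PhiE], and one each from the Euler steps, the shift
   of [y] by [a], [A m] and [Bad n]. The seventh share is slack. *)
rewrite addr0; set eta := e / 7.
have eta0 : 0 < eta by rewrite divr_gt0.
have mS s : 0 <= s -> measurable_fun setT (S s).
  by move=> s0; apply: (adapted_at_measurable filtF s0) => A mA; exact: adaptS.
have mle (X : T -> R) x : measurable_fun setT X -> measurable [set w | X w <=
  x].
  move=> mX; rewrite (_ : [set w | _] = X @^-1` `]-oo, x]); last first.
    by apply/seteqP; split=> w /=; rewrite in_itv.
  by rewrite -[X in measurable X]setTI; exact: mX.
have grid0 n k : 0 <= k%:R * (t / n%:R) by rewrite mulr_ge0// divr_ge0// ltW.
(* Only grid times enter, so [A m] is a countable union of events. Off [A m], freezing the drift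
   below the level changes nothing at the grid points. *)
pose A m := \bigcup_n \bigcup_(k in [set k | (k <= n)%N])
  [set w | S (k%:R * (t / n%:R)) w < m.+1%:R^-1].
have mA m : measurable (A m).
  apply: bigcup_measurable => n _; apply: bigcup_measurable => k _.
  rewrite (_ : [set w | _] = S (k%:R * (t / n%:R)) @^-1` `]-oo, m.+1%:R^-1[);
    last first.
    by apply/seteqP; split=> w /=; rewrite in_itv.
  by rewrite -[X in measurable X]setTI; apply: mS.
have [m /(_ m (leqnn m)) PAm] : exists N : nat, forall n, (N <= n)%N -> fine (P
  (A n)) <= eta.
  apply: ae_eventually_probability => //; apply: aeW => w.
  have [N HN] := @grid_infimum_eventually (S^~ w) t (ltW t0) (@contS w) (fun r
    => @S_gt0 r w).
  exists N => n Nn [n' _ [k /= kn']]; apply/negP; rewrite -leNgt.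
  exact: HN.
have [eps [Phi [rho [B [L [M [/andP[eps0 epsm] L0 D PhiE]]]]]]] :=
  @approx eta m.+1%:R^-1 eta0 (ltac:(by rewrite invr_gt0 ltr0n)).
have M0 : 0 <= M := le_trans (normr_ge0 _) (density_bounded D 0).
(* Tolerance between path and scheme: [Phi] is [M]-Lipschitz, so a shift by [a] costs at most [eta].
   The added 1 avoids dividing by 0. *)
pose a := eta / (M + 1).
have a0 : 0 < a by rewrite divr_gt0// ltr_wpDl.
have aM : M * a <= eta.
  by rewrite /a mulrCA ler_piMr ?(ltW eta0)// ler_pdivrMr ?ltr_wpDl// mul1r
    lerDl.
have PhiM x x' : `|Phi x - Phi x'| <= M * `|x - x'|.
  apply: mean_value_bound => u _;
    [exact: (cdf_derive D)|exact: (density_bounded D)].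
have [K [K0 HK]] := cdf_almost_invariant D L0.
pose be x := b (Num.max x eps).
have be_noninc x x' : x <= x' -> be x' <= be x.
  move=> xx'; apply: b_noninc; first by rewrite lt_max eps0 orbT.
  by rewrite ge_max !le_max xx' lexx orbT.
pose X n := euler_process W be (t / n%:R) (S 0) n.
have adS0 : adapted_at F 0 (S 0) by move=> C mC; exact: adaptS.
have mX n : (0 < n)%N -> measurable_fun setT (X n).
  move=> n0; have h0 : 0 < t / n%:R by rewrite divr_gt0// ltr0n.
  exact: adapted_at_measurable (adapted_euler_process filtF wienerW D h0 adS0
    n).
(* There is no positive step for [n = 0], where [Bad] is set to be empty. *)
pose Bad n := if (0 < n)%N then ~` A m `&` [set w | a < `|S t w - X n w|] else
  set0.
have mBad n : measurable (Bad n).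
  rewrite /Bad; case: ifPn => // n0; apply: measurableI;
    first exact: measurableC.
  have mD : measurable_fun setT (fun w => `|S t w - X n w|).
    apply: measurableT_comp => //; apply: measurable_funB;
      [exact/mS/ltW|exact: mX].
  rewrite (_ : [set w | _] = (fun w => `|S t w - X n w|) @^-1` `]a, +oo[);
    last first.
    by apply/seteqP; split=> w /=; rewrite in_itv/= andbT.
  by rewrite -[X in measurable X]setTI; exact: mD.
have [N PBad] : exists N : nat, forall n, (N <= n)%N -> fine (P (Bad n)) <= eta.
  apply: ae_eventually_probability => //; apply: filterS sdeS => w Sw.
  (* A residual of [a / t] per unit of time adds up to [a] over the [n] steps. *)
  have at0 : 0 < a / t by rewrite divr_gt0.
  have [N HN] := sde_path_residual (@contS w) (fun r => @S_gt0 r w) (@b_cont)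
    Sw t0 at0.
  exists (maxn N (Num.truncn (t * L)).+1) => n; rewrite geq_max => /andP[Nn Ln].
  rewrite /Bad; case: ifPn => [n0 [nAw /= aX]|_ []];
    suff : `|S t w - X n w| <= a by rewrite leNgt aX.
  have nR : 0 < n%:R :> R by rewrite ltr0n.
  have hL : t / n%:R * L <= 1.
    by rewrite mulrAC ler_pdivrMr// mul1r (le_trans (ltW (truncnS_gt _)))//
      ler_nat.
  have h0 : 0 <= t / n%:R by rewrite divr_ge0 ?ltW.
  have := @euler_scheme_stable R be L (t / n%:R) (a / t * (t / n%:R))
    (fun k => S (k%:R * (t / n%:R)) w) (fun k => W (k%:R * (t / n%:R)) w) n
    be_noninc (drift_lipschitz D) h0 hL.
  rewrite mul0r (mulrC n%:R (t / n%:R)) divfK ?gt_eqF//.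
  have -> : n%:R * (a / t * (t / n%:R)) = a.
    by field; rewrite !gt_eqF.
  apply => k kn; have := HN n Nn n0 (t / n%:R) k erefl kn.
  have -> // : be (S (k%:R * (t / n%:R)) w) = b (S (k%:R * (t / n%:R)) w).
  rewrite /be max_l//; apply: (le_trans (ltW epsm)); rewrite leNgt.
  by apply/negP => Sk; apply: nAw; exists n => //; exists k => //=; exact: ltnW.
(* The scheme accumulates an error [K * t * Num.sqrt h] in law. With [Num.sqrt h <= r] this is at
   most [eta], and [r <= 1] yields [h <= 1]. *)
pose r := Num.min (eta / (K * t + 1)) 1.
have Kt1 : 0 < K * t + 1 by rewrite ltr_wpDl// mulr_ge0// ltW.
have r0 : 0 < r by rewrite lt_min divr_gt0// ltr01.
(* [N] makes [Bad n] unlikely, the second bound gives [h <= r ^+ 2], the third [h * L < 1]. *)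
pose n := maxn N (maxn (Num.truncn (t / r ^+ 2)).+1 (Num.truncn (t * L)).+1).
have Nn : (N <= n)%N by exact: leq_maxl.
have n1 : ((Num.truncn (t / r ^+ 2)).+1 <= n)%N by rewrite !leq_max leqnn orbT.
have n2 : ((Num.truncn (t * L)).+1 <= n)%N by rewrite !leq_max leqnn !orbT.
have n0 : (0 < n)%N by exact: leq_trans n1.
have nR : 0 < n%:R :> R by rewrite ltr0n.
pose h := t / n%:R.
have h0 : 0 < h by rewrite divr_gt0.
have hr : h <= r ^+ 2.
  rewrite ler_pdivrMr// mulrC -ler_pdivrMr ?exprn_gt0//.
  by rewrite (le_trans (ltW (truncnS_gt _)))// ler_nat.
have r1 : r <= 1 by rewrite ge_min lexx orbT.
have h1 : h <= 1 by rewrite (le_trans hr)// exprn_ile1// ltW.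
have hL : h * L < 1.
  by rewrite mulrAC ltr_pdivrMr// mul1r (lt_le_trans (truncnS_gt _))// ler_nat.
have sh : Num.sqrt h <= r by rewrite -[leRHS](ger0_norm (ltW r0)) -sqrtr_sqr
  ler_sqrt ?exprn_ge0// ltW.
have [U [UE Und Ule]] := euler_inverse (drift_bounded D) (drift_lipschitz D)
  (ltW h0) hL.
have mU : measurable_fun setT U by exact: nondecreasing_measurable.
have Xcdf := euler_process_cdf filtF wienerW D h0 adS0 Und Ule (HK h U h0 h1 UE
  mU) PhiE n.
have nK : n%:R * (K * (h * Num.sqrt h)) <= eta.
  have -> : n%:R * (K * (h * Num.sqrt h)) = K * t * Num.sqrt h.
    by rewrite /h; field; rewrite gt_eqF.
  have Kt0 : 0 <= K * t by rewrite mulr_ge0// ltW.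
  rewrite (le_trans (ler_wpM2l Kt0 sh))//.
  have rr : r <= eta / (K * t + 1) by rewrite ge_min lexx.
  rewrite (le_trans (ler_wpM2l Kt0 rr))// mulrCA ler_piMr ?(ltW eta0)//.
  by rewrite ler_pdivrMr// mul1r lerDl.
have BadE w : ~ A m w -> ~ Bad n w -> `|S t w - X n w| <= a.
  move=> nAw; rewrite /Bad n0 => nB; rewrite leNgt; apply/negP => aw.
  by apply: nB.
have mSt := mS t (ltW t0).
have up : fine (P [set w | S t w <= y]) <=
    fine (P [set w | X n w <= y + a]) + (fine (P (A m)) + fine (P (Bad n))).
  apply: fine_probability_le3 => //; [exact: mle|exact/mle/mX|].
  move=> w /= Sy; have [Aw|nAw] := pselect (A m w); first by right; left.
  have [Bw|nBw] := pselect (Bad n w); first by right; right.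
  by left => /=; have := BadE w nAw nBw; rewrite ler_norml => /andP[]; lra.
have down : fine (P [set w | X n w <= y - a]) <=
    fine (P [set w | S t w <= y]) + (fine (P (A m)) + fine (P (Bad n))).
  apply: fine_probability_le3 => //; [exact/mle/mX|exact: mle|].
  move=> w /= Sy; have [Aw|nAw] := pselect (A m w); first by right; left.
  have [Bw|nBw] := pselect (Bad n w); first by right; right.
  by left => /=; have := BadE w nAw nBw; rewrite ler_norml => /andP[]; lra.
have PBn := PBad n Nn.
have a_abs : `|a| = a by rewrite gtr0_norm.
have u1 := PhiM (y + a) y; rewrite addrAC subrr add0r a_abs in u1.
have u2 := PhiM (y - a) y; rewrite addrAC subrr add0r normrN a_abs in u2.
have u3 := Xcdf (y + a); have u4 := Xcdf (y - a); have u5 := PhiE y.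
have etaE : e = 7 * eta by rewrite /eta; field.
move: u1 u2 u3 u4 u5; rewrite -/(X n) !ler_norml.
move=> /andP[? ?] /andP[? ?] /andP[? ?] /andP[? ?] /andP[? ?].
by apply/andP; split; lra.
Qed.

Lemma law_invariant :
  (forall e e0, 0 < e -> 0 < e0 -> exists eps Phi rho B L M,
    [/\ 0 < eps < e0, 0 <= L,
        drift_cdf (fun x => b (Num.max x eps)) Phi rho B L M &
        forall x, `|cdf0 x - Phi x| <= e]) ->
  forall t A, 0 <= t -> measurable A -> P (S t @^-1` A) = P (S 0 @^-1` A).
Proof.
move=> approx t A t0; have mS s : 0 <= s -> measurable_fun setT (S s).
  by move=> s0; apply: (adapted_at_measurable filtF s0) => B mB; exact: adaptS.
apply: eq_law; [exact: mS|exact: mS|] => x; exact: cdf_invariant.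
Qed.

End invariance.

(** * Freezing the drift near the origin *)

Section truncated_drift.
Context {R : realType}.

(** At the junction, Caratheodory's criterion reduces the claim to continuity of the slope
    functions: both pieces have slopes continuous at [a] with the same value there. *)
Lemma is_derive_if (g k dg dk : R -> R) (a : R) :
  g a = k a -> dg a = dk a ->
  (forall x : R, x <= a -> is_derive x 1 g (dg x)) ->
  (forall x : R, a <= x -> is_derive x 1 k (dk x)) ->
  forall x : R, is_derive x 1 (fun u => if u <= a then g u else k u)
    (if x <= a then dg x else dk x).
Proof.
move=> gka dgka Dg Dk x; have [xa|ax|->] := ltgtP x a.
- have := Dg x (ltW xa); apply: near_eq_is_derive.
    by near=> u; rewrite ifT//; apply: ltW; near: u; exact: lt_nbhsl.
- have := Dk x (ltW ax); apply: near_eq_is_derive.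
    by near=> u; rewrite ifF//; apply/negbTE; rewrite -ltNge; near: u;
      exact: lt_nbhsr.
- have /is_derive1_caratheodory[g' [gE cg' g'a]] := Dg a (lexx a).
  have /is_derive1_caratheodory[k' [kE ck' k'a]] := Dk a (lexx a).
  apply/is_derive1_caratheodory; exists (fun u => if u <= a then g' u else k'
    u).
  split => [z||]; last by rewrite lexx.
    by rewrite lexx; case: ifPn => _; rewrite ?gE// gka kE.
  apply/cvgrPdist_le => e e0; rewrite lexx.
  have /cvgrPdist_le/(_ _ e0) ng := cg'.
  have /cvgrPdist_le/(_ _ e0) nk := ck'.
  near=> u; case: ifPn => _; first by near: u.
  by rewrite g'a dgka -k'a; near: u.
Unshelve. all: by end_near. Qed.

Variables (b b' F psi : R -> R) (m C : R).
Hypothesis psi_derive : forall x : R, 0 < x -> is_derive x 1 psi (2 * b x * psi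
  x).
Hypothesis F_derive : forall x : R, 0 < x -> is_derive x 1 F (psi x).
Hypothesis b_derive : forall x : R, 0 < x -> is_derive x 1 b (b' x).
Hypothesis psi_bound : forall x, 0 < x -> 0 <= psi x <= m.
Hypothesis F_bound : forall x, 0 <= F x <= 1.
Hypothesis F_nondecr : forall x y, x <= y -> F x <= F y.
Hypothesis b_lower : forall x, 0 < x -> - C <= b x.
Hypothesis b'_bound : forall eps, 0 < eps -> exists L, forall x, eps <= x ->
  `|b' x| <= L.
Hypothesis b_noninc : forall x y, 0 < x -> x <= y -> b y <= b x.

(* Below [eps] the drift is frozen at the constant [b eps], so that its
   stationary density is exponential there. *)
Lemma truncated_drift_cdf (eps : R) : 0 < eps -> 0 < b eps ->
  exists Phi rho B L M, [/\ 0 <= L,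
    drift_cdf (fun x => b (Num.max x eps)) Phi rho B L M &
    forall x, `|F x - Phi x| <= F eps + psi eps / (2 * b eps)].
Proof.
move=> eps0 beps0; set be := b eps.
(* [ex] solves [u' = 2 * be * u] with value 1 at [eps]. The factors and constants in [Phi] and [rho]
   make both match [F] and [psi] at [eps]. *)
pose ex x := expR (2 * be * (x - eps)).
pose Phi x := if x <= eps then F eps + psi eps / (2 * be) * (ex x - 1) else F x.
pose rho x := if x <= eps then psi eps * ex x else psi x.
have [L HL] := b'_bound eps0.
have L0 : 0 <= L := le_trans (normr_ge0 _) (HL eps (lexx _)).
have /andP[pe0 pem] := psi_bound eps0.
have ex0 x : 0 < ex x by exact: expR_gt0.
have ex1 x : x <= eps -> ex x <= 1.
  by move=> xe; rewrite -expR0 ler_expR pmulr_rle0 ?subr_le0// mulr_gt0.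
have exE : ex eps = 1 by rewrite /ex subrr mulr0 expR0.
have dex (x : R) : is_derive x 1 ex (2 * be * ex x).
  have -> : ex = expR \o ((2 * be) *: (id - cst eps)) by apply/funext.
  by apply: is_derive_eq; rewrite /ex /= subr0 /GRing.scale/=; ring.
have quot0 : 0 <= psi eps / (2 * be) by rewrite divr_ge0// ltW// mulr_gt0.
have Fe := F_bound eps.
have pos x : eps <= x -> 0 < x by exact: lt_le_trans.
exists Phi, rho, (`|be| + `|C|), L, (m + 1 + psi eps / (2 * be)); split => //.
- split.
  + move=> x; have xe0 : 0 < Num.max x eps by rewrite lt_max eps0 orbT.
    have := b_lower xe0.
    have : b (Num.max x eps) <= be by apply: b_noninc => //;
      rewrite le_max lexx orbT.
    have := ler_norm be; have := ler_norm C; have := normr_ge0 be;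
      have := normr_ge0 C.
    by rewrite ler_norml => *; apply/andP; split; lra.
  + move=> x y.
    have me z : eps <= Num.max z eps by rewrite le_max lexx orbT.
    wlog xy : x y / x <= y.
      move=> hwlog; have [/hwlog//|/ltW/hwlog] := leP x y.
      by rewrite distrC (distrC y).
    have mxy : Num.max x eps <= Num.max y eps by rewrite ge_max !le_max xy lexx
      orbT.
    rewrite distrC (distrC x) (@ger0_norm _ (y - x)) ?subr_ge0//.
    (* Truncation by [Num.max] with [eps] is nonexpansive, and [b] is [L]-Lipschitz from [eps]
       on. *)
    apply: (@le_trans _ _ (L * (Num.max y eps - Num.max x eps))).
      apply: (@mean_value_segment _ b b' _ _ L mxy) => u /andP[/(le_trans (me
        x)) eu _]; last exact: HL.
      by apply: b_derive; exact: pos.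
    have xm : x <= Num.max x eps by rewrite le_max lexx.
    have em := me x; have : Num.max y eps <= Num.max x eps + (y - x).
      by rewrite ge_max; apply/andP; split; lra.
    by move=> myx; rewrite ler_wpM2l//; lra.
  + move=> x; rewrite /rho; apply: (@is_derive_if (fun u => F eps + psi eps /
    (2 * be) * (ex u - 1)) F
        (fun u => psi eps * ex u) psi) => [||u ue|u ue].
    * by rewrite exE subrr mulr0 addr0.
    * by rewrite exE mulr1.
    * have -> : (fun u => F eps + psi eps / (2 * be) * (ex u - 1)) =
          cst (F eps) + (psi eps / (2 * be)) *: (ex - cst 1) by apply/funext.
      by apply: is_derive_eq; rewrite /GRing.scale/=; field; rewrite gt_eqF.
    * by apply: F_derive; exact: pos.
  + move=> x.
    have -> : 2 * b (Num.max x eps) * rho x =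
        if x <= eps then psi eps * (2 * be * ex x) else 2 * b x * psi x.
      rewrite /rho; have [xe|//] := leP x eps.
      by rewrite -/be; ring.
    apply: (@is_derive_if (fun u => psi eps * ex u) psi (fun u => psi eps * (2
      * be * ex u)) (fun u => 2 * b u * psi u)).
    * by rewrite exE mulr1.
    * by rewrite exE mulr1 mulrC.
    * by move=> u ue; apply: psi_derive; exact: pos.
  + move=> x; rewrite /rho; have [xe|xe] := leP x eps.
      rewrite ger0_norm ?mulr_ge0 ?(ltW (ex0 _))//.
      have := ler_wpM2l pe0 (ex1 _ xe); lra.
    have /andP[? ?] := psi_bound (pos _ (ltW xe)).
    by rewrite ger0_norm//; lra.
  + move=> x; rewrite /Phi; have [xe|xe] := leP x eps.
      have := ler_wpM2l quot0 (ex1 _ xe); have := mulr_ge0 quot0 (ltW (ex0 x)).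
      move: Fe => /andP[? ?] *; rewrite ler_norml; apply/andP; split; lra.
    have /andP[? ?] := F_bound x.
    by rewrite ger0_norm//; lra.
- move=> x; rewrite /Phi; have [xe|xe] := leP x eps; last first.
    by rewrite subrr normr0 addr_ge0//; case/andP: Fe.
  have := F_nondecr xe; have /andP[? _] := F_bound x.
  have := ler_wpM2l quot0 (ex1 _ xe); have := mulr_ge0 quot0 (ltW (ex0 x)).
  move: Fe => /andP[? ?] *; rewrite ler_norml; apply/andP; split; lra.
Qed.

End truncated_drift.

(** * The relativistic Ornstein-Uhlenbeck drift and density *)

Section rou_drift.
Context {R : realType}.
Variables (d : nat) (gamma : R).
Hypothesis d_ge2 : (2 <= d)%N.
Hypothesis gamma_gt : d%:R - 1 < gamma.

Definition rou_drift (x : R) : R :=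
  (d%:R - 1) / 2 * coth x - gamma / 2 * tanh x.

Definition rou_weight (x : R) : R := cosh x `^ (- gamma) * sinh x ^+ d.-1.

Let d1E : d%:R - 1 = (d.-1)%:R :> R.
Proof. by case: d d_ge2 => //= n _; rewrite -natr1 addrK. Qed.

Let d1_ge1 : 1 <= (d.-1)%:R :> R.
Proof. by rewrite ler1n; case: d d_ge2 => [|[]]. Qed.

Let gamma_gt1 : 1 < gamma.
Proof. by rewrite (le_lt_trans _ gamma_gt)// d1E. Qed.

(** The logarithmic derivative of the weight is [(d - 1) * coth x - gamma * tanh x], twice the
    drift. *)
Lemma is_derive_rou_weight (x : R) : 0 < x ->
  is_derive x 1 rou_weight (2 * rou_drift x * rou_weight x).
Proof.
move=> x0; have c0 := cosh_gt0 x; have s0 := sinh_gt0 x0.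
have -> : rou_weight = ((@powR R ^~ (- gamma)) \o cosh) * (sinh ^+ d.-1).
  by apply/funext => u; rewrite /rou_weight !fctE.
have dp := @is_derive1_powR R (- gamma) _ c0.
apply: is_derive_eq; rewrite !fctE /= /GRing.scale /= /rou_drift /coth /tanh
  d1E.
rewrite powRB; last by apply/implyP => _; rewrite gt_eqF.
rewrite powRr1 ?(ltW c0)//.
(* Differentiating the power yields the exponent [d.-1.-1], a genuine predecessor because
   [2 <= d]. *)
have -> : sinh x ^+ d.-1 = sinh x ^+ d.-1.-1 * sinh x.
  by case: d d_ge2 => [|[|n]] //= _; rewrite exprSr.
by field; rewrite !gt_eqF.
Qed.

Lemma is_derive_rou_drift (x : R) : 0 < x -> is_derive x 1 rou_drift
  (- ((d%:R - 1) / 2 * sinh x ^- 2 + gamma / 2 * cosh x ^- 2)).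
Proof.
move=> x0; have c0 := cosh_gt0 x; have s0 := sinh_gt0 x0.
have -> : rou_drift = (((d%:R - 1) / 2) *: (cosh * (fun u => (sinh u)^-1))
    - (gamma / 2) *: (sinh * (fun u => (cosh u)^-1))).
  by apply/funext => u; rewrite /rou_drift !fctE.
have ds : is_derive x 1 (fun u : R => (sinh u)^-1) (- sinh x ^- 2 *: cosh x).
  by apply: is_deriveV; rewrite gt_eqF.
have dc : is_derive x 1 (fun u : R => (cosh u)^-1) (- cosh x ^- 2 *: sinh x).
  by apply: is_deriveV; rewrite gt_eqF.
apply: is_derive_eq; rewrite /GRing.scale /=.
have e := cosh2Bsinh2 x.
have e1 : cosh x ^+ 2 = 1 + sinh x ^+ 2 by rewrite -e; ring.
transitivity ((d%:R - 1) / 2 * ((sinh x ^+ 2 - cosh x ^+ 2) / sinh x ^+ 2) -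
  gamma / 2 * ((cosh x ^+ 2 - sinh x ^+ 2) / cosh x ^+ 2)).
  by field; rewrite !gt_eqF.
rewrite e -[sinh x ^+ 2 - _]opprB e; field; rewrite !gt_eqF//.
Qed.

Lemma rou_drift_noninc (x y : R) : 0 < x -> x <= y -> rou_drift y <= rou_drift
  x.
Proof.
move=> x0 xy; rewrite -subr_le0.
pose b' (u : R) := - ((d%:R - 1) / 2 * sinh u ^- 2 + gamma / 2 * cosh u ^- 2).
move: xy; rewrite le_eqVlt => /predU1P[->|xy]; first by rewrite subrr.
have pos u : x <= u -> 0 < u by exact: lt_le_trans.
have [||c cxy ->] := @MVT R rou_drift b' x y xy.
- by move=> u; rewrite in_itv/= => /andP[/ltW/pos u0 _];
  exact: is_derive_rou_drift.
- apply: continuous_in_subspaceT => u;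
  rewrite inE /= in_itv/= => /andP[/pos u0 _].
  exact: is_derive_continuous (is_derive_rou_drift u0).
rewrite nmulr_rle0 ?subr_ge0 ?(ltW xy)// oppr_lt0.
move: cxy; rewrite in_itv/= => /andP[/ltW/pos c0 _].
have s0 := sinh_gt0 c0; have ch0 := cosh_gt0 c.
rewrite addr_gt0// mulr_gt0 ?divr_gt0 ?invr_gt0 ?exprn_gt0//.
  by rewrite d1E; exact: lt_le_trans d1_ge1.
exact: lt_trans gamma_gt1.
Qed.

Lemma rou_drift_derive_bounded (eps : R) : 0 < eps -> exists L, forall x, eps
  <= x ->
  `|- ((d%:R - 1) / 2 * sinh x ^- 2 + gamma / 2 * cosh x ^- 2)| <= L.
Proof.
move=> eps0; exists ((d%:R - 1) / 2 * sinh eps ^- 2 + gamma / 2) => x ex.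
have se0 := sinh_gt0 eps0; have sx : sinh eps <= sinh x by rewrite ler_sinh.
have s0 : 0 < sinh x by exact: lt_le_trans sx.
have c0 := cosh_gt0 x; have c1 := cosh_ge1 x.
have g0 : 0 <= gamma / 2 by rewrite divr_ge0// ltW// (lt_trans _ gamma_gt1).
have h0 : 0 <= (d%:R - 1) / 2 :> R by rewrite divr_ge0// d1E.
rewrite normrN ger0_norm; last first.
  by rewrite addr_ge0// mulr_ge0// invr_ge0 exprn_ge0 ?ltW.
rewrite lerD//.
  by rewrite ler_wpM2l// lef_pV2 ?posrE ?exprn_gt0// lerXn2r ?nnegrE ?(ltW se0)
    ?(ltW s0).
by rewrite ler_piMr// invf_le1 ?exprn_gt0// exprn_ege1.
Qed.

Lemma rou_drift_lower (x : R) : 0 < x -> - (gamma / 2) <= rou_drift x.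
Proof.
move=> x0; have s0 := sinh_gt0 x0; have c0 := cosh_gt0 x.
have t1 : tanh x <= 1.
  by rewrite /tanh ler_pdivrMr// mul1r (le_trans (ler_norm _))// ltW//
    sinh_lt_cosh.
have g0 : 0 <= gamma / 2 by rewrite divr_ge0// ltW// (lt_trans _ gamma_gt1).
have := ler_wpM2l g0 t1.
have : 0 <= (d%:R - 1) / 2 * coth x.
  by rewrite /coth d1E !mulr_ge0 ?invr_ge0 ?(ltW s0) ?(ltW c0).
by rewrite /rou_drift; lra.
Qed.

Lemma sinh_ge0 (x : R) : 0 <= x -> 0 <= sinh x.
Proof. by move=> x0; rewrite -sinh0 ler_sinh. Qed.

Lemma rou_weight_ge0 (x : R) : 0 <= x -> 0 <= rou_weight x.
Proof. by move=> x0; rewrite mulr_ge0 ?powR_ge0// exprn_ge0// sinh_ge0. Qed.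

Lemma continuous_rou_weight : continuous rou_weight.
Proof.
move=> x; have c0 := cosh_gt0 x; have dp := @is_derive1_powR R (- gamma) _ c0.
have -> : rou_weight = ((@powR R ^~ (- gamma)) \o cosh) * (sinh ^+ d.-1).
  by apply/funext => u; rewrite /rou_weight !fctE.
by apply: is_derive_continuous.
Qed.

(** From [sinh x <= cosh x]. The resulting exponent is negative, whence the bound by 1 and
    integrability at infinity. *)
Lemma rou_weight_le (x : R) : 0 <= x -> rou_weight x <= cosh x `^ (d%:R - 1 -
  gamma).
Proof.
move=> x0; have c0 := cosh_gt0 x.
rewrite (addrC (d%:R - 1)) powRD; last by apply/implyP => _; rewrite gt_eqF.
rewrite ler_wpM2l ?powR_ge0// d1E powR_mulrn ?(ltW c0)//.
rewrite lerXn2r ?nnegrE ?(ltW c0) ?sinh_ge0//.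
by rewrite (le_trans (ler_norm _))// ltW// sinh_lt_cosh.
Qed.

Lemma rou_weight_le1 (x : R) : 0 <= x -> rou_weight x <= 1.
Proof.
move=> x0; rewrite (le_trans (rou_weight_le x0))//.
by rewrite -[leRHS](powRr0 (cosh x)) ler_powR ?cosh_ge1// subr_le0 ltW.
Qed.

End rou_drift.

(** * Change of variables and the hyperbolic tangent *)

Section substitution.
Context {R : realType}.
Local Notation mu := (@lebesgue_measure R).

(** Positivity of the derivative is asked only for [0 < u]: [sinh], the derivative of [cosh],
    vanishes at 0. *)
Lemma integration_by_substitution_pos (Phi phi G g : R -> R) (y : R) : 0 < y ->
  (forall u : R, is_derive u 1 Phi (phi u)) -> continuous phi ->
  (forall u, 0 < u -> 0 < phi u) ->
  {within `[Phi 0, Phi y], continuous G} ->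
  (forall u, 0 <= u <= y -> G (Phi u) * phi u = g u) ->
  (\int[mu]_(x in `[Phi 0%R, Phi y]) (G x)%:E = \int[mu]_(x in `[0%R, y]) (g
    x)%:E)%E.
Proof.
move=> y0 dPhi cphi phi0 cG Gg.
have cPhi : continuous Phi by move=> u; exact: is_derive_continuous (dPhi u).
have dE : Phi^`()%classic = phi by apply/funext => u;
  rewrite derive1E derive_val.
rewrite integration_by_substitution_increasing ?dE ?(ltW y0)//.
- by apply: eq_integral => x; rewrite inE /= in_itv/= => x0y;
  rewrite !fctE /= Gg.
- move=> a c; rewrite !in_itv/= => /andP[a0 _] /andP[_ cy] ac.
  have [|e + e1] := @MVT R Phi phi a c ac; first exact: continuous_subspaceT.
  rewrite in_itv/= => /andP[ae _]; rewrite -subr_gt0 e1.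
  by rewrite mulr_gt0 ?subr_gt0// phi0// (le_lt_trans a0).
- by apply: cvgP; apply: cvg_at_right_filter; exact: cphi.
- by apply: cvgP; apply: cvg_at_left_filter; exact: cphi.
- split; first by move=> u _; exact: ex_derive.
  + exact/cvg_at_right_filter/cPhi.
  + exact/cvg_at_left_filter/cPhi.
Qed.

Lemma cosh_ge_expR (x : R) : expR x / 2 <= cosh x.
Proof. by rewrite /cosh ler_pM2r// lerDl expR_ge0. Qed.

Global Instance is_derive_tanh (x : R) : is_derive x 1 (@tanh R) (cosh x ^- 2).
Proof.
have c0 := cosh_gt0 x.
have dc : is_derive x 1 (fun u : R => (cosh u)^-1) (- cosh x ^- 2 *: sinh x).
  by apply: is_deriveV; rewrite gt_eqF.
have -> : @tanh R = sinh * (fun u => (cosh u)^-1) by apply/funext.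
apply: is_derive_eq; rewrite /GRing.scale /=.
transitivity ((cosh x ^+ 2 - sinh x ^+ 2) / cosh x ^+ 2).
  by field; rewrite gt_eqF.
by rewrite cosh2Bsinh2 div1r.
Qed.

Lemma tanh_lt1 (x : R) : tanh x < 1.
Proof.
by rewrite /tanh ltr_pdivrMr ?cosh_gt0// mul1r (le_lt_trans (ler_norm _))//
  sinh_lt_cosh.
Qed.

Lemma tanh0 : tanh 0 = 0 :> R.
Proof. by rewrite /tanh sinh0 mul0r. Qed.

Lemma onemB_tanh2 (x : R) : 1 - tanh x ^+ 2 = cosh x ^- 2.
Proof.
have c0 := cosh_gt0 x; rewrite /tanh expr_div_n.
transitivity ((cosh x ^+ 2 - sinh x ^+ 2) / cosh x ^+ 2).
  by field; rewrite gt_eqF.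
by rewrite cosh2Bsinh2 div1r.
Qed.

Lemma ler_tanh : {mono (@tanh R) : x y / x <= y}.
Proof.
apply: le_mono => x y xy.
have [|e _ e1] := @MVT R tanh (fun u => cosh u ^- 2) x y xy.
  by apply: continuous_subspaceT => u; exact: is_derive_continuous.
by rewrite -subr_gt0 e1 mulr_gt0 ?subr_gt0// invr_gt0 exprn_gt0// cosh_gt0.
Qed.

(** [tanh x] is [1 - expR (- x) / cosh x], and [expR x >= 1 + x]. The explicit rate shows that the
    intervals [[0, tanh n]] exhaust [[0, 1[]. *)
Lemma tanh_ge (x : R) : 0 <= x -> 1 - (1 + x)^-1 <= tanh x.
Proof.
move=> x0; have c0 := cosh_gt0 x; have c1 := cosh_ge1 x.
have -> : tanh x = 1 - expR (- x) / cosh x.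
  rewrite /tanh; have -> : expR (- x) = cosh x - sinh x by rewrite /cosh /sinh;
    field.
  by field; rewrite gt_eqF.
rewrite lerD2l lerN2 expRN -invfM lef_pV2 ?posrE ?mulr_gt0 ?expR_gt0
  ?ltr_wpDr//.
- by rewrite (le_trans (expR_ge1Dx x))// ler_peMr// expR_ge0.
- exact: expR_gt0.
Qed.

End substitution.

(** * The normalized density and its images *)

Section rou_density.
Context {R : realType}.
Variables (d : nat) (gamma : R).
Hypothesis d_ge2 : (2 <= d)%N.
Hypothesis gamma_gt : d%:R - 1 < gamma.
Local Notation mu := (@lebesgue_measure R).
Local Notation weight := (@rou_weight R d gamma).
Local Notation N := (norm_const d gamma).

Let mweight (D : set R) : measurable D -> measurable_fun D (EFin \o weight).
Proof.
move=> mD; apply/measurable_EFinP; apply: measurable_funTS.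
by apply: continuous_measurable_fun; exact: continuous_rou_weight.
Qed.

(** Since [cosh x >= expR x / 2], the weight is at most [c] times the exponential density of rate
    [dl], the gap between [gamma] and [d - 1]. *)
Lemma rou_weight_integral_lty : (\int[mu]_(x in `[0%R, +oo[) (weight x)%:E <
  +oo)%E.
Proof.
pose dl := gamma - (d%:R - 1); have dl0 : 0 < dl by rewrite subr_gt0.
pose c := ((2^-1) `^ dl)^-1 / dl.
have h0 : 0 < (2^-1 : R) `^ dl by rewrite powR_gt0.
have c0 : 0 <= c by rewrite divr_ge0 ?invr_ge0 ?(ltW h0) ?(ltW dl0).
have mexp : measurable_fun setT (EFin \o exponential_pdf dl).
  by apply/measurable_EFinP; exact: measurable_exponential_pdf.
apply: (@le_lt_trans _ _ (\int[mu]_(x in `[0%R, +oo[) (c%:E * (exponential_pdf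
  dl x)%:E))%E).
  apply: ge0_le_integral => //=.
  - move=> x; rewrite /= in_itv/= andbT => x0.
    by rewrite lee_fin rou_weight_ge0.
  - exact: mweight.
  - by apply: measurable_funTS; exact: measurable_funeM.
  move=> x; rewrite /= in_itv/= andbT => x0; rewrite -EFinM lee_fin.
  rewrite (le_trans (rou_weight_le _ d_ge2 x0))//.
  rewrite exponential_pdfE// /c mulrA divfK ?gt_eqF//.
  rewrite (_ : d%:R - 1 - gamma = - dl); last by rewrite /dl opprB.
  rewrite powRN mulNr expRN -invfM lef_pV2 ?posrE ?mulr_gt0 ?expR_gt0 ?powR_gt0
    ?cosh_gt0//.
  rewrite mulrC (mulrC dl) expRM -powRM ?expR_ge0// ?invr_ge0//.
  by rewrite ge0_ler_powR ?nnegrE ?(ltW dl0) ?(ltW (cosh_gt0 _))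
    ?cosh_ge_expR// divr_ge0// expR_ge0.
rewrite ge0_integralZl//=.
- apply: (@le_lt_trans _ _ (c%:E * 1)%E); last by rewrite mule1 ltry.
  rewrite lee_wpmul2l ?lee_fin// -(integral_exponential_pdf dl0).
  by apply: ge0_subset_integral => //= x _;
    rewrite lee_fin exponential_pdf_ge0// ltW.
- exact: measurable_funTS.
- by move=> x _; rewrite lee_fin exponential_pdf_ge0// ltW.
Qed.

Lemma norm_constE : (\int[mu]_(x in `[0%R, +oo[) (weight x)%:E = N%:E)%E.
Proof.
rewrite /norm_const /Rintegral fineK// ge0_fin_numE.
  exact: rou_weight_integral_lty.
by apply: integral_ge0 => x; rewrite /= in_itv/= andbT => x0;
  rewrite lee_fin rou_weight_ge0.
Qed.

Lemma norm_const_gt0 : 0 < N.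
Proof.
(* On [[1, 2]] the decreasing factor of the weight is smallest at 2 and the increasing one at 1. *)
pose m : R := cosh 2 `^ (- gamma) * sinh 1 ^+ d.-1.
have m0 : 0 < m by rewrite mulr_gt0 ?powR_gt0 ?cosh_gt0 ?exprn_gt0 ?sinh_gt0.
have gamma0 : 0 <= gamma.
  rewrite ltW// (le_lt_trans _ gamma_gt)// subr_ge0 ler1n; exact: ltnW.
rewrite -lte_fin -norm_constE.
apply: (@lt_le_trans _ _ (\int[mu]_(x in `[1%R, 2%R]) m%:E)%E).
  rewrite integral_cst//= lebesgue_measure_itv/= lte_fin ltr1n/= -EFinB -EFinM
    lte_fin.
  by rewrite mulr_gt0// subr_gt0 ltr1n.
apply: (@le_trans _ _ (\int[mu]_(x in `[1%R, 2%R]) (weight x)%:E)%E).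
  apply: ge0_le_integral => //=.
  - by move=> x _; rewrite lee_fin ltW.
  - exact: mweight.
  move=> x; rewrite /= in_itv/= => /andP[x1 x2]; rewrite lee_fin.
  have x0 : 0 <= x by rewrite (le_trans _ x1).
  rewrite ler_pM ?powR_ge0 ?exprn_ge0 ?sinh_ge0//.
    rewrite !powRN lef_pV2 ?posrE ?powR_gt0 ?cosh_gt0//.
    rewrite ge0_ler_powR ?nnegrE ?(ltW (cosh_gt0 _))// ler_cosh//.
    by rewrite !ger0_norm.
  by rewrite lerXn2r ?nnegrE ?sinh_ge0// ler_sinh.
apply: ge0_subset_integral => //=.
- exact: mweight.
- by move=> x; rewrite /= in_itv/= andbT => x0; rewrite lee_fin rou_weight_ge0.
- move=> x; rewrite /= !in_itv/= andbT => /andP[x1 _].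
  by rewrite (le_trans _ x1).
Qed.

Definition rou_density (x : R) : R := N^-1 * weight x.

Lemma rou_density_ge0 (x : R) : 0 <= x -> 0 <= rou_density x.
Proof.
by move=> x0; rewrite mulr_ge0 ?invr_ge0 ?(ltW norm_const_gt0)// rou_weight_ge0.
Qed.

Lemma continuous_rou_density : continuous rou_density.
Proof.
by move=> x; apply: cvgM; [exact: cvg_cst|exact: continuous_rou_weight].
Qed.

Lemma integral_rou_density : (\int[mu]_(x in `[0%R, +oo[) (rou_density x)%:E =
  1)%E.
Proof.
have N0 := norm_const_gt0.
rewrite /rou_density; under eq_integral do rewrite EFinM.
rewrite ge0_integralZl//=.
- by rewrite norm_constE -EFinM mulVf// gt_eqF.
- exact: mweight.
- by move=> x; rewrite /= in_itv/= andbT => x0; rewrite lee_fin rou_weight_ge0.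
- by rewrite lee_fin invr_ge0 ltW.
Qed.

(* For [1 <= p] the power [(p ^+ 2 - 1) `^ ((d - 2) / 2)] is a natural power of
   a square root, hence continuous at [p = 1] too. *)
Lemma integral_phi_energy (y : R) : 0 < y ->
  (\int[mu]_(p in `[1%R, cosh y]) (phi_energy d gamma p)%:E =
   \int[mu]_(x in `[0%R, y]) (rou_density x)%:E)%E.
Proof.
move=> y0.
pose G (p : R) := N^-1 * (p `^ (- gamma) * Num.sqrt (p ^+ 2 - 1) ^+ d.-2).
transitivity (\int[mu]_(p in `[1%R, cosh y]) (G p)%:E)%E.
  apply: eq_integral => p; rewrite inE /= in_itv/= => /andP[p1 py].
  congr EFin; rewrite /phi_energy /G indicE mem_set /= ?in_itv/= ?p1// mulr1.
  congr (_ * (_ * _)).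
  have -> : (d%:R - 2) / 2 = 2^-1 * (d.-2)%:R :> R.
    by case: d d_ge2 => [|[|n]]//= _; rewrite -addn2 natrD addrK mulrC.
  by rewrite powRrM powR12_sqrt ?powR_mulrn ?sqrtr_ge0// subr_ge0 exprn_ege1.
rewrite -cosh0; apply: (@integration_by_substitution_pos _ cosh sinh) => //.
- by move=> u; exact: is_derive_continuous.
- exact: sinh_gt0.
- apply: continuous_in_subspaceT => p; rewrite inE /= in_itv/= => /andP[p1 _].
  have p0 : 0 < p by rewrite (lt_le_trans _ p1)// cosh_gt0.
  apply: cvgM; first exact: cvg_cst.
  apply: cvgM.
    by have := @is_derive1_powR R (- gamma) _ p0; exact: is_derive_continuous.
  apply: (@continuous_comp _ _ _ (fun p : R => Num.sqrt (p ^+ 2 - 1)) (fun u =>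
    u ^+ d.-2)); last exact: exprn_continuous.
  apply: (@continuous_comp _ _ _ (fun p : R => p ^+ 2 - 1) Num.sqrt);
    last exact: sqrt_continuous.
  apply: cvgB; last exact: cvg_cst.
  exact: exprn_continuous.
move=> u /andP[u0 _]; rewrite /G /rou_density /rou_weight -!mulrA;
  congr (_ * (_ * _)).
have -> : cosh u ^+ 2 - 1 = sinh u ^+ 2 by rewrite -(cosh2Bsinh2 u); ring.
rewrite sqrtr_sqr ger0_norm ?sinh_ge0// -exprSr.
by case: d d_ge2 => [|[|n]].
Qed.

(** Substituting [v = tanh u], both [1 - v ^+ 2] and the Jacobian are [cosh u ^- 2]; the exponents
    of [cosh u] add up to [- gamma]. As [tanh y < 1], a possible singularity of [phi_speed] at 1 is
    avoided. *)
Lemma integral_phi_speed (y : R) : 0 < y ->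
  (\int[mu]_(v in `[0%R, tanh y]) (phi_speed d gamma v)%:E =
   \int[mu]_(x in `[0%R, y]) (rou_density x)%:E)%E.
Proof.
move=> y0; rewrite -{1}tanh0.
apply: (@integration_by_substitution_pos _ tanh (fun u => cosh u ^- 2)) => //.
- move=> u; apply: cvgV; first by rewrite expf_neq0// gt_eqF// cosh_gt0.
  apply: (@continuous_comp _ _ _ cosh (fun u => u ^+ 2));
    last exact: exprn_continuous.
  exact: is_derive_continuous.
- by move=> u _; rewrite invr_gt0 exprn_gt0// cosh_gt0.
- apply: continuous_in_subspaceT => v;
  rewrite inE /= in_itv/= tanh0 => /andP[v0 vy].
  have v1 : 0 < 1 - v ^+ 2.
    by rewrite subr_gt0 exprn_ilt1// (le_lt_trans vy)// tanh_lt1.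
  apply: cvgM; first exact: cvg_cst.
  apply: cvgM; first exact: exprn_continuous.
  apply: (@continuous_comp _ _ _ (fun v : R => 1 - v ^+ 2) (@powR R ^~ ((gamma
    - (d%:R + 1)) / 2))).
    by apply: cvgB; [exact: cvg_cst|exact: exprn_continuous].
  by have := @is_derive1_powR R ((gamma - (d%:R + 1)) / 2) _ v1;
    exact: is_derive_continuous.
move=> u /andP[u0 _]; rewrite /phi_speed /rou_density /rou_weight onemB_tanh2.
have c0 := cosh_gt0 u.
have dE : (d.-1)%:R = d%:R - 1 :> R by case: d d_ge2 => //= n _;
  rewrite -natr1 addrK.
have e : cosh u `^ (- (d.-1)%:R) *
    (cosh u `^ (- 2%:R * ((gamma - (d%:R + 1)) / 2)) * cosh u `^ (- 2%:R)) =
    cosh u `^ (- gamma).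
  have u_neq0 : cosh u != 0 by rewrite gt_eqF.
  by rewrite -!powRD ?u_neq0 ?implybT//; congr powR; rewrite dE; field.
rewrite -e (powRrM _ (- 2%:R)) !powR_invn ?(ltW c0)// /tanh expr_div_n; ring.
Qed.

End rou_density.

Section densities.
Context {R : realType}.
Variables (d : nat) (gamma : R).
Hypothesis d_ge2 : (2 <= d)%N.
Hypothesis gamma_gt : d%:R - 1 < gamma.
Local Notation mu := (@lebesgue_measure R).
Local Notation dens := (rou_density d gamma).

Lemma measurable_phi_energy : measurable_fun [set: R] (phi_energy d gamma).
Proof.
apply: measurable_funM; last exact: measurable_indic.
apply: measurable_funM; first exact: measurable_cst.
apply: measurable_funM; first exact: measurable_powR.
apply: (measurableT_comp (measurable_powR _)).
by apply: measurable_funB => //; exact: measurable_funX.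
Qed.

Lemma measurable_phi_speed : measurable_fun [set: R] (phi_speed d gamma).
Proof.
apply: measurable_funM; first exact: measurable_cst.
apply: measurable_funM; first exact: measurable_funX.
apply: (measurableT_comp (measurable_powR _)).
by apply: measurable_funB => //; exact: measurable_funX.
Qed.

Lemma phi_energy_ge0 (p : R) : 0 <= phi_energy d gamma p.
Proof.
by rewrite !mulr_ge0 ?invr_ge0 ?(ltW (norm_const_gt0 _ _)) ?powR_ge0// indicE.
Qed.

Lemma phi_speed_ge0 (v : R) : 0 <= v -> 0 <= phi_speed d gamma v.
Proof.
by move=> v0; rewrite !mulr_ge0 ?invr_ge0 ?(ltW (norm_const_gt0 _ _)) ?powR_ge0
  ?exprn_ge0.
Qed.

(** Monotone convergence on both sides. The upper bounds start at 1 because the substitutions need a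
    positive endpoint. *)
Lemma exhausting_integral1 (E : nat -> set R) (f : R -> R) :
  nondecreasing_seq E -> (forall n, measurable (E n)) ->
  measurable_fun [set: R] f -> (forall n x, E n x -> 0 <= f x) ->
  (forall n, (\int[mu]_(x in E n) (f x)%:E =
    \int[mu]_(x in `[0%R, n.+1%:R]) (dens x)%:E)%E) ->
  (\int[mu]_(x in \bigcup_n E n) (f x)%:E = 1)%E.
Proof.
move=> ndE mE mf f0 Ef.
have lim0 : (\int[mu]_(x in `[0%R, n.+1%:R]) (dens x)%:E @[n --> \oo] --> (1 :
  \bar R))%E.
  rewrite -(integral_rou_density d_ge2 gamma_gt).
  have -> : `[0, +oo[%classic = \bigcup_n `[0, n.+1%:R]%classic :> set R.
    apply/seteqP; split=> x /=.
      rewrite in_itv/= andbT => x0; exists (Num.truncn x) => //=.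
      by rewrite in_itv/= x0 ltW// truncnS_gt.
    by case=> n _ /=; rewrite !in_itv/= andbT => /andP[].
  apply: ge0_nondecreasing_set_cvg_integral => //.
  - move=> n m nm; apply/subsetPset => x /=; rewrite !in_itv/= => /andP[-> xn].
    by rewrite (le_trans xn)// ler_nat ltnS.
  - move=> n; apply/measurable_EFinP; apply: measurable_funTS.
    by apply: continuous_measurable_fun; exact: continuous_rou_density.
  - by move=> n x /=; rewrite in_itv/= => /andP[x0 _];
    rewrite lee_fin rou_density_ge0.
have limE : (\int[mu]_(x in E n) (f x)%:E @[n --> \oo] -->
    \int[mu]_(x in \bigcup_n E n) (f x)%:E)%E.
  apply: ge0_nondecreasing_set_cvg_integral => // n.
  by apply/measurable_EFinP; exact: measurable_funTS.
rewrite -(cvg_lim (@ereal_hausdorff R) limE) -(cvg_lim (@ereal_hausdorff R)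
  lim0).
by congr (lim (_ @ \oo)); apply/funext.
Qed.

Lemma integral_phi_energy1 : (\int[mu]_(p in `[1%R, +oo[) (phi_energy d gamma
  p)%:E = 1)%E.
Proof.
have -> : `[1, +oo[%classic = \bigcup_n `[1, cosh n.+1%:R]%classic :> set R.
  apply/seteqP; split=> x /=.
    (* [cosh n] is at least [expR n / 2], hence exceeds [n / 2]. *)
    rewrite in_itv/= andbT => x1; exists (Num.truncn (2 * x)) => //=.
    rewrite in_itv/= x1/=; have := @cosh_ge_expR R (Num.truncn (2 * x)).+1%:R.
    have := truncnS_gt (2 * x); have := expR_ge1Dx ((Num.truncn (2 * x)).+1%:R
      : R).
    by lra.
  by case=> n _ /=; rewrite !in_itv/= andbT => /andP[].
apply: exhausting_integral1 => //.
- move=> n m nm; apply/subsetPset => x /=; rewrite !in_itv/= => /andP[-> xn].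
  by rewrite (le_trans xn)// ler_cosh// !ger0_norm// ler_nat ltnS.
- exact: measurable_phi_energy.
- by move=> n x _; exact: phi_energy_ge0.
- by move=> n; rewrite integral_phi_energy.
Qed.

Lemma integral_phi_speed1 : (\int[mu]_(v in `[0%R, 1%R]) (phi_speed d gamma
  v)%:E = 1)%E.
Proof.
(* [tanh] never reaches 1, so this null point is removed before exhausting the interval. *)
rewrite -integral_itv_bndo_bndc; last first.
  by apply/measurable_EFinP; apply: measurable_funTS;
    exact: measurable_phi_speed.
have -> : `[0, 1[%classic = \bigcup_n `[0, tanh n.+1%:R]%classic :> set R.
  apply/seteqP; split=> x /=.
    rewrite in_itv/= => /andP[x0 x1]; exists (Num.truncn (1 - x)^-1) => //=.
    rewrite in_itv/= x0/= (le_trans _ (tanh_ge _))//.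
    have x10 : 0 < 1 - x by rewrite subr_gt0.
    rewrite lerBrDr addrC -lerBrDr.
    rewrite invf_ple ?posrE// ?ltr_wpDr//.
    by rewrite (le_trans (ltW (truncnS_gt _)))// lerDr.
  case=> n _ /=; rewrite !in_itv/= => /andP[-> xn] /=.
  by rewrite (le_lt_trans xn)// tanh_lt1.
apply: exhausting_integral1 => //.
- move=> n m nm; apply/subsetPset => x /=; rewrite !in_itv/= => /andP[-> xn].
  by rewrite (le_trans xn)// ler_tanh ler_nat ltnS.
- exact: measurable_phi_speed.
- by move=> n x /=; rewrite in_itv/= => /andP[x0 _]; exact: phi_speed_ge0.
- by move=> n; rewrite integral_phi_speed.
Qed.

Lemma prob_density_phi_energy : prob_density setT (phi_energy d gamma).
Proof.
split; [exact: measurable_phi_energy|by move=> x _; exact: phi_energy_ge0|].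
rewrite -integral_phi_energy1 [RHS]integral_mkcond; apply: eq_integral => x _.
rewrite patchE; case: ifPn => // x1.
by rewrite /phi_energy indicE (negbTE x1) mulr0.
Qed.

Lemma prob_density_phi_speed : prob_density `[0, 1] (phi_speed d gamma).
Proof.
split; last exact: integral_phi_speed1.
- by apply: measurable_funTS; exact: measurable_phi_speed.
- by move=> x /=; rewrite in_itv/= => /andP[x0 _]; exact: phi_speed_ge0.
Qed.

Section initial_law.
Context {dT : measure_display} {T : measurableType dT}.
Variables (P : probability T R) (X : T -> R).
Hypothesis X_gt0 : forall w, 0 < X w.

(** [cosh] is increasing on the positive values of [X], and the indicator in [phi_energy] removes
    the part of the half-line below 1. *)
Lemma cdf_of_energy_density (x : R) : 0 < x ->
  has_density P setT (cosh \o X) (phi_energy d gamma) ->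
  P [set w | X w <= x] = (\int[mu]_(u in `[0%R, x]) (dens u)%:E)%E.
Proof.
move=> x0 /(_ `]-oo, cosh x]%classic (measurable_itv _)).
rewrite setIT -(integral_phi_energy gamma d_ge2 x0).
have -> : (cosh \o X) @^-1` `]-oo, cosh x] = [set w | X w <= x].
  apply/seteqP; split=> w /=; rewrite in_itv/=.
    by apply: contraTT; rewrite -!ltNge => xX; rewrite ltr_cosh// ltW.
  by move=> Xx; rewrite ler_cosh// !gtr0_norm.
move=> ->; rewrite [LHS]integral_mkcond [RHS]integral_mkcond.
apply: eq_integral => p _; rewrite !patchE.
have -> : (p \in `[1, cosh x]%classic) = (p \in `]-oo, cosh x]%classic) && (1
  <= p).
  by apply/idP/andP; rewrite !inE /= !in_itv/=;
    [move=> /andP[-> ->]|move=> [-> ->]].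
case: (p \in _) => //=; case: ifPn => // p1.
by rewrite /phi_energy indicE memNset ?mulr0//= in_itv/= andbT; exact/negP.
Qed.

Lemma cdf_of_speed_density (x : R) : 0 < x ->
  has_density P `[0, 1] (tanh \o X) (phi_speed d gamma) ->
  P [set w | X w <= x] = (\int[mu]_(u in `[0%R, x]) (dens u)%:E)%E.
Proof.
move=> x0 /(_ `]-oo, tanh x]%classic (measurable_itv _)).
rewrite -(integral_phi_speed gamma d_ge2 x0).
have -> : (tanh \o X) @^-1` `]-oo, tanh x] = [set w | X w <= x].
  by apply/seteqP; split=> w /=; rewrite in_itv/= ler_tanh.
suff -> : `]-oo, tanh x] `&` `[0, 1] = `[0, tanh x]%classic :> set R by [].
apply/seteqP; split=> v /=; rewrite !in_itv/=; first by move=> [-> /andP[->]].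
move=> /andP[v0 vx]; split=> //; rewrite v0/= (le_trans vx)//.
by rewrite ltW// tanh_lt1.
Qed.

End initial_law.
End densities.

(** * Invariance of the law of the diffusion *)

Section rou_invariance.
Context {R : realType} {dT : measure_display} {T : measurableType dT}.
Variables (d : nat) (gamma : R).
Hypothesis d_ge2 : (2 <= d)%N.
Hypothesis gamma_gt : d%:R - 1 < gamma.
Variable P : probability T R.
Variables (F : R -> set (set T)) (W S : R -> T -> R).
Hypotheses (filtF : is_filtration F) (wienerW : is_wiener P F W).
Hypothesis diffS : is_rou_diffusion P d gamma F W S.
Local Notation mu := (@lebesgue_measure R).
Local Notation dens := (rou_density d gamma).
Local Notation N := (norm_const d gamma).

(** It remains to find good frozen approximations: freezing below [eps] costs
    [cdf eps + dens eps / (2 * b eps)] with [b] the drift, and this is small for small [eps] because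
    the drift stays at least 1/2 there. *)
Lemma rou_law_invariant :
  (forall x : R, 0 < x ->
    P [set w | S 0 w <= x] = (\int[mu]_(u in `[0%R, x]) (dens u)%:E)%E) ->
  forall t A, 0 <= t -> measurable A -> P (S t @^-1` A) = P (S 0 @^-1` A).
Proof.
move=> S0E.
have N0 : 0 < N^-1 by rewrite invr_gt0 norm_const_gt0.
have gamma0 : 0 < gamma.
  by rewrite (le_lt_trans _ gamma_gt)// subr_ge0 ler1n; exact: ltnW.
pose cdf x := fine (P [set w | S 0 w <= x]).
have mS0 x : measurable [set w | S 0 w <= x].
  rewrite (_ : [set w | _] = S 0 @^-1` `]-oo, x]); last first.
    by apply/seteqP; split=> w /=; rewrite in_itv.
  apply: (filtration_measurable filtF (lexx 0)).
  by apply: (rou_adapted diffS).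
have dens_le x : 0 < x -> 0 <= dens x <= N^-1.
  move=> x0; rewrite rou_density_ge0 ?(ltW x0)//=.
  by rewrite ler_piMr ?(ltW N0)// rou_weight_le1 ?ltW.
have cdf_derive (x : R) : 0 < x -> is_derive x 1 cdf (dens x).
  move=> x0; pose I u := \int[mu]_(t in `[0, u]) dens t.
  have dI : is_derive x 1 I (dens x).
    have [|||dI I'E] := @continuous_FTC1_closed R dens 0 x (x + 1) _ _ x0.
    - by rewrite ltrDl.
    - apply: continuous_compact_integrable; first exact: segment_compact.
      by apply: continuous_subspaceT; exact: continuous_rou_density.
    - exact: continuous_rou_density.
    by apply: DeriveDef => //; rewrite -derive1E.
  apply: near_eq_is_derive dI; near=> u.
  by rewrite /cdf S0E//; near: u; exact: lt_nbhsr.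
have dens_derive (x : R) : 0 < x ->
    is_derive x 1 dens (2 * rou_drift d gamma x * dens x).
  move=> x0; have dw := is_derive_rou_weight gamma d_ge2 x0.
  have -> : dens = N^-1 *: rou_weight d gamma by apply/funext.
  by apply: is_derive_eq; rewrite !fctE /GRing.scale /=; ring.
have cdf_bound x : 0 <= cdf x <= 1.
  by rewrite fine_ge0//= -lee_fin fineK ?fin_num_measure// probability_le1.
have cdf_nondecr x y : x <= y -> cdf x <= cdf y.
  move=> xy; apply: fine_le; rewrite ?fin_num_measure//.
  by apply: le_measure; rewrite ?inE// => w /= /le_trans; apply.
apply: (law_invariant filtF wienerW (b := rou_drift d gamma) (rou_adapted diffS)
  (rou_continuous diffS) (rou_gt0 diffS) (rou_sde diffS)).
- by move=> x x0; exact: is_derive_continuous (is_derive_rou_drift _ _ x0).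
- by move=> x y x0; exact: rou_drift_noninc.
move=> e e0 e_gt0 e0_gt0.
(* The three bounds serve, in turn, to absorb the power of [sinh eps], to make [N^-1 * sig] at most
   [e / 2], and to force [coth eps >= 1 + gamma], hence a drift of at least 1/2. *)
pose sig := Num.min 1 (Num.min (e / 2 / N^-1) (1 + gamma)^-1).
have g1 : 0 < 1 + gamma by rewrite addr_gt0.
have sig0 : 0 < sig by rewrite !lt_min ltr01 !divr_gt0//= invr_gt0.
have c1 := cosh_ge1 (1 : R).
have c0 : 0 < cosh (1 : R) := cosh_gt0 1.
(* As [eps <= 1], [sinh eps <= eps * cosh eps <= eps * cosh 1 <= sig]. *)
pose eps := Num.min (e0 / 2) (sig / cosh 1).
have eps0 : 0 < eps by rewrite lt_min !divr_gt0.
have epse0 : eps < e0.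
  by rewrite gt_min; apply/orP; left; rewrite ltr_pdivrMr// ltr_pMr// ltr1n.
have epss : eps * cosh 1 <= sig by rewrite -ler_pdivlMr// ge_min lexx orbT.
have epssig : eps <= sig by rewrite (le_trans _ epss)// ler_peMr// ltW.
have sig1 : sig <= 1 by rewrite ge_min lexx.
have sige : N^-1 * sig <= e / 2.
  by rewrite mulrC -ler_pdivlMr// !ge_min lexx orbT.
have sigg : sig * (1 + gamma) <= 1.
  by rewrite -ler_pdivlMr// div1r !ge_min lexx !orbT.
have se0 := sinh_gt0 eps0.
have ses : sinh eps <= sig.
  have := sinh_le_mulcosh eps; rewrite !gtr0_norm// => /le_trans; apply.
  rewrite (le_trans _ epss)// ler_pM2l// ler_cosh// !gtr0_norm//.
  exact: le_trans epssig sig1.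
have bge : 1 / 2 <= rou_drift d gamma eps.
  have ceps := cosh_ge1 eps; have ceps0 := cosh_gt0 eps.
  have t1 := ltW (tanh_lt1 eps).
  have cth : 1 + gamma <= coth eps.
    rewrite /coth ler_pdivlMr// (le_trans _ ceps)// mulrC (le_trans _ sigg)//.
    by rewrite ler_pM2r.
  have d1 : 1 <= d%:R - 1 :> R by rewrite lerBrDr (_ : 1 + 1 = 2%:R) ?ler_nat.
  rewrite /rou_drift.
  have g20 : 0 <= gamma / 2 by rewrite divr_ge0// ltW.
  have h1 := ler_wpM2l g20 t1.
  have cth0 : 0 <= coth eps by rewrite (le_trans _ cth)// ltW.
  have h2 := ler_wpM2r cth0 d1.
  lra.
have b0 : 0 < rou_drift d gamma eps by rewrite (lt_le_trans _ bge)// divr_gt0.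
have [Phi [rho [B [L [M [L0 D PhiE]]]]]] :=
  truncated_drift_cdf dens_derive cdf_derive (is_derive_rou_drift d gamma)
  dens_le cdf_bound cdf_nondecr (rou_drift_lower d_ge2 gamma_gt)
  (rou_drift_derive_bounded d_ge2 gamma_gt) (rou_drift_noninc d_ge2 gamma_gt)
  eps0 b0.
exists eps, Phi, rho, B, L, M; split => //; first by rewrite eps0.
move=> x; rewrite (le_trans (PhiE x))//.
have cdf_eps : cdf eps <= e / 2.
  rewrite (le_trans _ sige)// (le_trans _ (ler_wpM2l (ltW N0) epssig))//.
  rewrite -lee_fin /cdf fineK ?fin_num_measure// S0E//.
  apply: (@le_trans _ _ (\int[mu]_(u in `[0%R, eps]) (N^-1)%:E)%E); last first.
    by rewrite integral_cst//= lebesgue_measure_itv/= lte_fin eps0 -EFinB subr0.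
  apply: ge0_le_integral => //=.
  - move=> u; rewrite /= in_itv/= => /andP[u0 _].
    by rewrite lee_fin rou_density_ge0.
  - apply/measurable_EFinP; apply: measurable_funTS.
    by apply: continuous_measurable_fun; exact: continuous_rou_density.
  move=> u; rewrite /= in_itv/= => /andP[u0 _]; rewrite lee_fin.
  by rewrite ler_piMr ?(ltW N0)// rou_weight_le1.
have dens_eps : dens eps <= e / 2.
  rewrite (le_trans _ sige)// ler_wpM2l ?(ltW N0)// (le_trans _ ses)//.
  rewrite /rou_weight powRN -[leRHS]mul1r ler_pM ?invr_ge0 ?powR_ge0 ?exprn_ge0
    ?(ltW se0)//.
    rewrite invf_le1 ?powR_gt0 ?cosh_gt0// -[leLHS](powRr0 (cosh eps)).
    by rewrite ler_powR ?cosh_ge1// ltW.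
  rewrite -[leRHS]expr1 ler_wiXn2l ?(ltW se0) ?(le_trans ses sig1)//.
  by case: d d_ge2 => [|[]].
have b1 : 1 <= 2 * rou_drift d gamma eps by lra.
have : dens eps / (2 * rou_drift d gamma eps) <= dens eps.
  by rewrite ler_piMr ?rou_density_ge0 ?(ltW eps0)// invf_le1// (lt_le_trans _
    b1).
lra.
Unshelve. all: by end_near. Qed.

End rou_invariance.

(** * Transfer to the energy and the speed *)

Section transfer.
Context {R : realType} {dT : measure_display} {T : measurableType dT}.
Variable P : probability T R.

Lemma invariant_density_comp (D : set R) (phi f : R -> R) (S : R -> T -> R) :
  prob_density D phi -> measurable_fun setT f ->
  (has_density P D (f \o S 0) phi ->
    forall t A, 0 <= t -> measurable A -> P (S t @^-1` A) = P (S 0 @^-1` A)) ->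
  invariant_density P D (fun t w => f (S t w)) phi.
Proof.
move=> pd mf inv; split=> // h0 t t0 A mA.
have mfA : measurable (f @^-1` A) by rewrite -[X in measurable X]setTI;
  exact: mf.
exact: etrans (inv h0 t _ t0 mfA) (h0 A mA).
Qed.

(** The clock integrates a nonnegative function, so it is a legitimate time, at which [Theta] is a
    unit vector; the Euclidean norm then leaves the nonnegative scalar [tanh (S t w)]. *)
Lemma speed_tanh (d : nat) (Theta : R -> T -> 'rV[R]_d) (S : R -> T -> R) (t :
  R) (w : T) :
  0 <= t -> 0 < S t w ->
  (forall s w, 0 <= s -> euclid_norm (Theta s w) = 1) ->
  speed Theta S t w = tanh (S t w).
Proof.
move=> t0 S0 Theta1; have c0 := cosh_gt0 (S t w); have s0 := sinh_gt0 S0.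
rewrite /speed /velocity /momentum /energy scalerA mulrC -/(tanh _).
have th0 : 0 <= tanh (S t w) by rewrite divr_ge0 ?ltW.
have clock0 : 0 <= clock S t w.
  by apply: Rintegral_ge0 => r _; rewrite invr_ge0 sqr_ge0.
rewrite /euclid_norm.
under eq_bigr do rewrite mxE exprMn.
rewrite -mulr_sumr sqrtrM ?sqr_ge0// sqrtr_sqr ger0_norm//.
by have := Theta1 _ w clock0; rewrite /euclid_norm => ->; rewrite mulr1.
Qed.

End transfer.

Theorem corollary5p3 (R : realType) (d : nat) (gamma : R)
    (d_ge2 : (2 <= d)%N) (gamma_gt : d%:R - 1 < gamma)
    (dT : measure_display) (T : measurableType dT) (P : probability T R)
    (F : R -> set (set T)) (W S : R -> T -> R)
    (filtF : is_filtration F) (wienerW : is_wiener P F W)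
    (diffS : is_rou_diffusion P d gamma F W S) :
  [/\ invariant_density P setT (energy S) (phi_energy d gamma),
      invariant_density P `[0, 1] (fun t w => tanh (S t w))
        (phi_speed d gamma) &
      forall Theta : R -> T -> 'rV[R]_d,
        is_sphere_wiener P Theta -> independent_of_diffusion P Theta S ->
        (forall t w, 0 <= t -> speed Theta S t w = tanh (S t w)) /\
        invariant_density P `[0, 1] (speed Theta S) (phi_speed d gamma)].
Proof.
have inv := rou_law_invariant d_ge2 gamma_gt filtF wienerW diffS.
have S0 : forall w, 0 < S 0 w by move=> w; exact: (rou_gt0 diffS).
have inv_tanh : invariant_density P `[0, 1] (fun t w => tanh (S t w))
  (phi_speed d gamma).
  apply: invariant_density_comp; first exact: prob_density_phi_speed.
    by apply: continuous_measurable_fun => u; exact: is_derive_continuous.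
  by move=> h0; apply: inv => x x0; exact: cdf_of_speed_density h0.
split=> //.
  apply: (@invariant_density_comp _ _ _ P _ _ cosh);
    first exact: prob_density_phi_energy.
    by apply: continuous_measurable_fun => u; exact: is_derive_continuous.
  by move=> h0; apply: inv => x x0; exact: cdf_of_energy_density h0.
move=> Theta wTheta _.
have speedE t w : 0 <= t -> speed Theta S t w = tanh (S t w).
  by move=> t0; apply: speed_tanh => //;
    [exact: (rou_gt0 diffS)|exact: (sphere_wiener_unit wTheta)].
split=> //; case: inv_tanh => pd invd; split=> // h0 t t0.
(* The two processes agree at times [0 <= s] only, so they are exchanged at each such time
   separately. *)
have speed_fun s : 0 <= s -> speed Theta S s = (fun w => tanh (S s w)).
  by move=> s0; apply/funext => w; exact: speedE.
by rewrite speed_fun//; apply: invd => //; rewrite -speed_fun.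
Qed.
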